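(* Let $G=U(1)\times SU(2)$ and let $g_l$ be a left-invariant Riemannian metric on $G$, with associated data $\lambda_1,\lambda_2,\lambda_3>0$, $e_0,e_1,e_2,e_3,E_0\in\mathfrak{g}$ as defined in the context. Then $(G,g_l)$ has nonnegative sectional curvature if and only if both of the following hold. (A) With $x=\lambda_1/\lambda_3$ and $y=\lambda_2/\lambda_3$, $$2x^2+2y^2-3+x^4-2x^2y^2+y^4\geq 0,$$ $$2x^2-3x^4+2x^2y^2-2y^2+1+y^4\geq 0,$$ $$2y^2-3y^4+2x^2y^2-2x^2+1+x^4\geq 0.$$ (B) At least one of the following conditions holds: (1) $E_0$ is parallel to $e_0$ (in this case, $g_l$ is a product metric); (2) $\lambda_1=\lambda_2=\lambda_3$ (in this case, $E_0$ is arbitrary); (3) for some permutation $(i,j,k)$ of $(1,2,3)$, $\lambda_i=\lambda_j$ and $E_0\in\mathrm{span}\{e_0,e_k\}$.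
   Context: Let $G=U(1)\times SU(2)$, with Lie algebra $\mathfrak{g}=\mathfrak{u}(1)\oplus\mathfrak{su}(2)$, and fix a bi-invariant Riemannian metric $g_0$ on $G$. Let $g_l$ be a left-invariant Riemannian metric on $G$. Let $\{u_1,u_2,u_3\}$ be a $g_0$-orthonormal basis of $\mathfrak{su}(2)$ consisting of eigenvectors of the restriction of $g_l$ to $\mathfrak{su}(2)$ relative to $g_0$, with corresponding eigenvalues $\lambda_1^2,\lambda_2^2,\lambda_3^2$ (with $\lambda_i>0$); that is, $g_l(u_i,X)=\lambda_i^2 g_0(u_i,X)$ for all $X\in\mathfrak{su}(2)$. Put $e_i=u_i/\lambda_i$ for $i=1,2,3$, so that $\{e_1,e_2,e_3\}$ is $g_l$-orthonormal. Let $e_0$ be a vector spanning the factor $\mathfrak{u}(1)$, and let $E_0$ be a $g_l$-unit vector spanning the $g_l$-orthogonal complement of $\mathfrak{su}(2)$ in $\mathfrak{g}$. *)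

(* Defs.v *)
From HB Require Import structures.
From mathcomp Require Import all_boot all_order all_algebra all_fingroup.
From mathcomp Require Import spectral sesquilinear.
From mathcomp Require Import all_classical all_reals all_analysis.
From mathcomp.real_closed Require Import complex.

Set Implicit Arguments.
Unset Strict Implicit.
Unset Printing Implicit Defensive.

Import Order.TTheory GRing.Theory Num.Theory.
Import numFieldNormedType.Exports.

Local Open Scope classical_set_scope.
Local Open Scope complex_scope.
Local Open Scope sesquilinear_scope.
Local Open Scope ring_scope.

(* C-infinity: every iterated directional derivative (the head of the list is
   the last direction used) is Frechet-differentiable everywhere. *)
Definition smooth (R : realType) (E : normedModType R) (F : E -> R) : Prop :=
  forall (s : seq E) (x : E),
    differentiable (foldr (fun v (h : E -> R) => fun y => 'D_v h y) F s) x.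

Section U1SU2.
Variable R : realType.

(* The real algebra of pairs of complex matrices; it contains both the group
   and its Lie algebra, and its ring product restricts to the group law. *)
Definition mat : Type := ('M[R[i]]_1 * 'M[R[i]]_2)%type.

Definition rscale (a : R) (x : mat) : mat := a%:C *: x.

Definition in_U1SU2 (p : mat) : bool :=
  [&& p.1 \is unitarymx, p.2 \is unitarymx & \det p.2 == 1].

Definition U1SU2 : Type := {p : mat | in_U1SU2 p}.

Lemma in_U1SU2_mul (p q : U1SU2) : in_U1SU2 (sval p * sval q).
Proof.
case: p q => [p /and3P[p1 p2 /eqP dp]] [q /and3P[q1 q2 /eqP dq]] /=.
apply/and3P; split; [exact: mul_unitarymx | exact: mul_unitarymx |].
by rewrite det_mulmx dp dq mulr1.
Qed.

Lemma in_U1SU2_one : in_U1SU2 1.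
Proof.
by apply/and3P; split; rewrite ?det1 //; apply/unitarymxP;
  rewrite trmx1 map_mx1 mulmx1.
Qed.

Definition mulG (p q : U1SU2) : U1SU2 :=
  exist _ (sval p * sval q) (in_U1SU2_mul p q).
Definition oneG : U1SU2 := exist _ 1 in_U1SU2_one.

Definition lieG : set mat :=
  [set x | [/\ x.1 ^t* = - x.1, x.2 ^t* = - x.2 & \tr x.2 = 0]].
Definition lieU1 : set mat := [set x | lieG x /\ x.2 = 0].
Definition lieSU2 : set mat := [set x | lieG x /\ x.1 = 0].

(* T_p G, as a real subspace of mat: the image of T_1 G = lieG under the
   differential of left translation by p. *)
Definition tangent (p : U1SU2) : set mat :=
  [set v | exists2 x, lieG x & v = sval p * x].

(* Real coordinates (real and imaginary parts of the entries) on mat, which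
   carry its topology and smooth structure. *)
Definition ambient : normedModType R :=
  (('M[R]_1 * 'M[R]_1) * ('M[R]_2 * 'M[R]_2))%type.
Definition coords (x : mat) : ambient :=
  ((map_mx (@complex.Re R) x.1, map_mx (@complex.Im R) x.1),
   (map_mx (@complex.Re R) x.2, map_mx (@complex.Im R) x.2)).

(* G is a closed embedded submanifold: its smooth functions are the
   restrictions of the smooth functions of the ambient space. *)
Definition extends (f : U1SU2 -> R) (F : ambient -> R) : Prop :=
  smooth F /\ forall p : U1SU2, F (coords (sval p)) = f p.
Definition smoothG (f : U1SU2 -> R) : Prop := exists F, extends f F.

(* Derivative of f at p along v, meant for f smooth and v in T_p G; its value
   does not depend on the smooth extension chosen. *)
Definition dirder (f : U1SU2 -> R) (p : U1SU2) (v : mat) : R :=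
  'D_(coords v) (get [set F | extends f F]) (coords (sval p)).

Definition applyvf (X : U1SU2 -> mat) (f : U1SU2 -> R) : U1SU2 -> R :=
  fun p => dirder f p (X p).

Definition vector_field (X : U1SU2 -> mat) : Prop :=
  (forall p, tangent p (X p)) /\ (forall f, smoothG f -> smoothG (applyvf X f)).

Definition is_bracket (X Y W : U1SU2 -> mat) : Prop :=
  vector_field W /\
  forall f, smoothG f -> forall p,
    applyvf W f p = applyvf X (applyvf Y f) p - applyvf Y (applyvf X f) p.

(* A tensor g is only meaningful on vectors tangent at its base point. *)
Definition riemannian (g : U1SU2 -> mat -> mat -> R) : Prop :=
  [/\ forall p v w, tangent p v -> tangent p w -> g p v w = g p w v,
      forall p a u v w, tangent p u -> tangent p v -> tangent p w ->
        g p (rscale a u + v) w = a * g p u w + g p v w,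
      forall p v, tangent p v -> v != 0 -> 0 < g p v v
    & forall X Y, vector_field X -> vector_field Y ->
        smoothG (fun p => g p (X p) (Y p))].

Definition left_invariant (g : U1SU2 -> mat -> mat -> R) : Prop :=
  forall q p v w, tangent p v -> tangent p w ->
    g (mulG q p) (sval q * v) (sval q * w) = g p v w.

Definition right_invariant (g : U1SU2 -> mat -> mat -> R) : Prop :=
  forall q p v w, tangent p v -> tangent p w ->
    g (mulG p q) (v * sval q) (w * sval q) = g p v w.

Definition bi_invariant (g : U1SU2 -> mat -> mat -> R) : Prop :=
  left_invariant g /\ right_invariant g.

(* h and k are not required to be metrics: when g is Riemannian, adding a
   constant to one and subtracting it from the other makes them so. *)
Definition product_metric (g : U1SU2 -> mat -> mat -> R) : Prop :=
  exists (h : 'M[R[i]]_1 -> 'M[R[i]]_1 -> 'M[R[i]]_1 -> R)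
         (k : 'M[R[i]]_2 -> 'M[R[i]]_2 -> 'M[R[i]]_2 -> R),
    forall p v w, tangent p v -> tangent p w ->
      g p v w = h (sval p).1 v.1 w.1 + k (sval p).2 v.2 w.2.

Definition connection (D : (U1SU2 -> mat) -> (U1SU2 -> mat) -> U1SU2 -> mat)
  : Prop :=
  [/\ forall X Y, vector_field X -> vector_field Y -> vector_field (D X Y),
      forall f X X' Y, smoothG f ->
        vector_field X -> vector_field X' -> vector_field Y ->
        forall p, D (fun q => rscale (f q) (X q) + X' q) Y p =
                  rscale (f p) (D X Y p) + D X' Y p
    & forall f X Y Y', smoothG f ->
        vector_field X -> vector_field Y -> vector_field Y' ->
        forall p, D X (fun q => rscale (f q) (Y q) + Y' q) p =
                  rscale (applyvf X f p) (Y p) + rscale (f p) (D X Y p)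
                  + D X Y' p].

Definition levi_civita (g : U1SU2 -> mat -> mat -> R)
    (D : (U1SU2 -> mat) -> (U1SU2 -> mat) -> U1SU2 -> mat) : Prop :=
  [/\ connection D,
      forall X Y, vector_field X -> vector_field Y ->
        is_bracket X Y (fun p => D X Y p - D Y X p)
    & forall X Y Z, vector_field X -> vector_field Y -> vector_field Z ->
        forall p, applyvf X (fun q => g q (Y q) (Z q)) p =
                  g p (D X Y p) (Z p) + g p (Y p) (D X Z p)].

(* R(X, Y) Z, where W is the bracket [X, Y]. *)
Definition curvature (D : (U1SU2 -> mat) -> (U1SU2 -> mat) -> U1SU2 -> mat)
    (X Y W Z : U1SU2 -> mat) : U1SU2 -> mat :=
  fun p => D X (D Y Z) p - D Y (D X Z) p - D W Z p.

Definition lin_indep (v w : mat) : Prop :=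
  forall a b : R, rscale a v + rscale b w = 0 -> a = 0 /\ b = 0.

Definition sectional (g : U1SU2 -> mat -> mat -> R)
    (D : (U1SU2 -> mat) -> (U1SU2 -> mat) -> U1SU2 -> mat)
    (X Y W : U1SU2 -> mat) (p : U1SU2) : R :=
  g p (curvature D X Y W Y p) (X p) /
  (g p (X p) (X p) * g p (Y p) (Y p) - g p (X p) (Y p) ^+ 2).

(* Every tangent 2-plane at p is spanned by the values at p of two vector
   fields X and Y. *)
Definition nonneg_sectional (g : U1SU2 -> mat -> mat -> R)
    (D : (U1SU2 -> mat) -> (U1SU2 -> mat) -> U1SU2 -> mat) : Prop :=
  forall X Y W, vector_field X -> vector_field Y -> is_bracket X Y W ->
  forall p, lin_indep (X p) (Y p) -> 0 <= sectional g D X Y W p.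

End U1SU2.

(* Main.v *)
(* Every vector field is a combination, with smooth coefficients, of
   left-invariant fields, and the curvature is tensorial, so sectional
   curvatures are computed on the Lie algebra, where Koszul's formula determines
   the connection. In a gl-orthonormal basis (E0, e1, e2, e3) one has
   [e_i, e_j] = L_k e_k cyclically, with L_i proportional to lambda_i^2, and
   ad E0 = ad (b1 e1 + b2 e2 + b3 e3) on su(2). The Ricci curvature of E0 is
   minus the squared norm of the symmetric part of ad E0, so nonnegative
   curvature forces b_i (L_j - L_k) = 0, which is condition (B). Under these
   equations the curvature form is that of SU(2), diagonal on the planes
   e_i, e_j, and its three coefficients are, up to a positive factor, the
   polynomials in (A). *)

Require Import Defs.
From HB Require Import structures.
From mathcomp Require Import all_boot all_order all_algebra all_fingroup.
From mathcomp Require Import spectral sesquilinear.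
From mathcomp Require Import all_classical all_reals all_analysis.
From mathcomp.real_closed Require Import complex.
From mathcomp Require Import ring lra.

Set Implicit Arguments.
Unset Strict Implicit.
Unset Printing Implicit Defensive.

Import Order.TTheory GRing.Theory Num.Theory.
Import numFieldNormedType.Exports.

Local Open Scope classical_set_scope.
Local Open Scope complex_scope.
Local Open Scope sesquilinear_scope.
Local Open Scope ring_scope.

(** * Smooth functions *)

Section Smooth.
Variables (R : realType) (E : normedModType R).
Implicit Types (F H : E -> R) (x v : E).

(** Derivatives on the group are taken through an arbitrarily chosen smooth extension, so
    independence of the choice requires a curve in the group through every tangent vector. Elements
    of the Lie algebra have scalar squares on each factor, hence rational curves a(t) + b(t) x can
    replace the exponential. Left-invariant fields are restrictions of the linear fields V -> V x
    and preserve restrictions of linear forms, so their brackets reduce to matrix products.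

    The structure constants cannot be read off explicit matrices, since the basis u_i is only known
    to be g0-orthonormal. Invariance of g0 under conjugation makes ad skew, hence [u_i, u_j] = c u_k
    cyclically, with c nonzero because su(2) is not abelian. Rescaling gives L_k = c lambda_k^2 /
    (lambda_1 lambda_2 lambda_3).

    The b_i are the coordinates of the su(2) component of E0 along u(1). They need not vanish
    although E0 is orthogonal to su(2), because u(1) is only a complement of su(2), not its
    orthogonal one. *)

Lemma smooth_differentiable F x : smooth F -> differentiable F x.
Proof. by move=> /(_ [::]). Qed.

Lemma smooth_derive F v : smooth F -> smooth (fun x => 'D_v F x).
Proof. by move=> sF s x; have := sF (rcons s v) x; rewrite foldr_rcons. Qed.

(** The derivative of a product is a sum of products, so an induction over the list of directions
    needs a class closed under both operations. One induction on this class then gives smoothness of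
    sums and of products. *)
Inductive smooth_alg : (E -> R) -> Prop :=
| SmoothGen F of smooth F : smooth_alg F
| SmoothAdd F H of smooth_alg F & smooth_alg H :
    smooth_alg (fun x => F x + H x)
| SmoothMul F H of smooth_alg F & smooth_alg H :
    smooth_alg (fun x => F x * H x).

Lemma smooth_alg_differentiable F x : smooth_alg F -> differentiable F x.
Proof.
by elim=> [G /smooth_differentiable // | G H _ dG _ dH | G H _ dG _ dH];
  [exact: differentiableD | exact: differentiableM].
Qed.

Lemma smooth_alg_derive F v :
  smooth_alg F -> smooth_alg (fun x => 'D_v F x).
Proof.
elim=> [G sG | G H sG dG sH dH | G H sG dG sH dH].
- exact/SmoothGen/smooth_derive.
- rewrite (_ : (fun x => 'D_v _ x) = fun x => 'D_v G x + 'D_v H x).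
    exact: SmoothAdd.
  by apply/funext => x; rewrite deriveD//;
    exact/diff_derivable/smooth_alg_differentiable.
- rewrite (_ : (fun x => 'D_v _ x) =
      fun x => G x * 'D_v H x + H x * 'D_v G x).
    by apply: SmoothAdd; apply: SmoothMul.
  by apply/funext => x; rewrite deriveM//;
    exact/diff_derivable/smooth_alg_differentiable.
Qed.

Lemma smooth_algE F : smooth_alg F -> smooth F.
Proof.
move=> + s; elim/last_ind: s F => [|s v IH] F sF x.
  exact: smooth_alg_differentiable.
by rewrite foldr_rcons; exact/IH/smooth_alg_derive.
Qed.

Lemma smoothD F H : smooth F -> smooth H -> smooth (fun x => F x + H x).
Proof. by move=> sF sH; apply/smooth_algE/SmoothAdd; exact: SmoothGen. Qed.

Lemma smoothM F H : smooth F -> smooth H -> smooth (fun x => F x * H x).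
Proof. by move=> sF sH; apply/smooth_algE/SmoothMul; exact: SmoothGen. Qed.

Lemma smooth_cst (c : R) : smooth (fun _ : E => c).
Proof.
move=> s; elim/last_ind: s c => [|s v IH] c x; first exact: differentiable_cst.
rewrite foldr_rcons (_ : (fun y => 'D_v _ y) = fun=> 0)//.
by apply/funext => y; exact: derive_cst.
Qed.

Lemma smooth_sum n (F : 'I_n -> E -> R) :
  (forall k, smooth (F k)) -> smooth (fun x => \sum_k F k x).
Proof.
elim: n F => [|n IH] F sF.
  rewrite (_ : (fun x => \sum_k _) = fun=> 0); first exact: smooth_cst.
  by apply/funext => x; rewrite big_ord0.
rewrite (_ : (fun x => \sum_k _) =
  fun x => F ord0 x + \sum_(k < n) F (lift ord0 k) x).
  by apply: smoothD => //; apply: IH.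
by apply/funext => x; rewrite big_ord_recl.
Qed.

Lemma deriveDr F x u v : smooth F -> 'D_(u + v) F x = 'D_u F x + 'D_v F x.
Proof.
by move=> /(smooth_differentiable x) dF; rewrite !deriveE// linearD.
Qed.

Lemma deriveZr F x (a : R) v : smooth F -> 'D_(a *: v) F x = a * 'D_v F x.
Proof.
by move=> /(smooth_differentiable x) dF; rewrite !deriveE// linearZ.
Qed.

Lemma derive_sumr n F x (v : 'I_n -> E) :
  smooth F -> 'D_(\sum_k v k) F x = \sum_k 'D_(v k) F x.
Proof.
by move=> /(smooth_differentiable x) dF; rewrite deriveE// linear_sum;
  apply: eq_bigr => k _; rewrite deriveE.
Qed.

Lemma derive_lin (m : {linear E -> R}) x v : continuous m -> 'D_v m x = m v.
Proof.
by move=> cm; rewrite deriveE; [rewrite diff_lin | exact: linear_differentiable].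
Qed.

Lemma smooth_lin (m : {linear E -> R}) : continuous m -> smooth m.
Proof.
move=> cm s; case/lastP: s => [|s v] x; first exact: linear_differentiable.
rewrite foldr_rcons (_ : (fun y => 'D_v _ y) = fun=> m v); first exact: smooth_cst.
by apply/funext => y; exact: derive_lin.
Qed.

(** By the chain rule both sides are the derivative at 0 of the function along [g]. This is what
    makes derivatives along tangent vectors independent of the smooth extension. *)
Lemma derive_eq_along_curve F H (g : R -> E) (x v : E) :
  smooth F -> smooth H -> g 0 = x -> is_diff (0 : R) g (fun t => t *: v) ->
  (forall t, F (g t) = H (g t)) -> 'D_v F x = 'D_v H x.
Proof.
move=> sF sH <- dg eqFH.
have along G : smooth G -> 'D_v G (g 0) = 'D_1 (G \o g) 0.
  move=> /(smooth_differentiable (g 0)) dG.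
  have dg0 : differentiable g (0 : R) by [].
  rewrite !deriveE//; last exact: differentiable_comp.
  have dg1 : 'd g (0 : R) 1 = v by rewrite diff_val scale1r.
  by rewrite [in RHS]diff_comp//= dg1.
by rewrite !along//; congr (derive _ _ _); apply/funext => t /=.
Qed.

End Smooth.

(** * Finite-dimensional normed spaces *)

Definition linear_of (R : realType) (E F : normedModType R) (f : E -> F)
  (lf : linear f) : {linear E -> F} :=
  HB.pack_for {linear E -> F} f (GRing.isLinear.Build _ _ _ _ _ lf).

(** Finite dimension in the form in which it is used: a reconstruction formula with continuous
    coefficient forms, which passes to products directly. *)
Definition finite_coords (R : realType) (E : normedModType R) : Prop :=
  exists n (m : 'I_n -> {linear E -> R}) (b : 'I_n -> E),
    (forall k, continuous (m k)) /\ forall x, x = \sum_k m k x *: b k.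

Section FiniteCoords.
Variable R : realType.

Lemma finite_coords_mx p q : finite_coords 'M[R]_(p.+1, q.+1).
Proof.
pose T : finType := ('I_p.+1 * 'I_q.+1)%type.
pose c (k : 'I_#|T|) (M : 'M[R]_(p.+1, q.+1)) : R :=
  M (enum_val k).1 (enum_val k).2.
have lc k : linear (c k) by move=> a M N; rewrite /c !mxE.
exists #|T|, (fun k => linear_of (lc k)),
  (fun k => delta_mx (enum_val k).1 (enum_val k).2).
split=> [k|M]; first exact: coord_continuous.
rewrite {1}(matrix_sum_delta M) pair_big /=.
by rewrite (reindex (@enum_val T predT)) //=; exact/onW_bij/enum_val_bij.
Qed.

Lemma finite_coords_prod (E1 E2 : normedModType R) :
  finite_coords E1 -> finite_coords E2 ->
  finite_coords (E1 * E2)%type.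
Proof.
move=> [n1 [m1 [b1 [cm1 e1]]]] [n2 [m2 [b2 [cm2 e2]]]].
pose m (k : 'I_(n1 + n2)) (x : E1 * E2) : R :=
  match fintype.split k with inl i => m1 i x.1 | inr j => m2 j x.2 end.
have lm k : linear (m k).
  by move=> a x y; rewrite /m; case: (fintype.split k) => i; rewrite linearP.
exists (n1 + n2)%N,
  (fun k => linear_of (lm k)),
  (fun k => match fintype.split k with inl i => (b1 i, 0) | inr j => (0, b2 j) end).
split=> [k z|x].
  rewrite /= /m; case: (fintype.split k) => i.
    by apply: (@continuous_comp _ _ _ fst (m1 i));
      [exact: cvg_fst | exact: cm1].
  by apply: (@continuous_comp _ _ _ snd (m2 i));
    [exact: cvg_snd | exact: cm2].
rewrite big_split_ord /= (eq_bigr (fun i => (m1 i x.1 *: b1 i, 0))); last first.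
  move=> i _; rewrite /m (unsplitK (inl i)).
  by congr pair; rewrite scaler0.
rewrite [X in _ + X](eq_bigr (fun i => (0, m2 i x.2 *: b2 i))); last first.
  move=> i _; rewrite /m (unsplitK (inr i)).
  by congr pair; rewrite scaler0.
have fstS n (F : 'I_n -> E1 * E2) : (\sum_i F i).1 = \sum_i (F i).1.
  exact: (big_morph fst).
have sndS n (F : 'I_n -> E1 * E2) : (\sum_i F i).2 = \sum_i (F i).2.
  exact: (big_morph snd).
case: x => x1 x2; congr pair; rewrite /= ?fstS ?sndS /=.
  by rewrite big1_eq addr0 -e1.
by rewrite big1_eq add0r -e2.
Qed.

Variable E : normedModType R.
Hypothesis fcE : finite_coords E.

Lemma finite_coords_continuous (m : {linear E -> R}) : continuous m.
Proof.
case: fcE => n [c [b [cc eb]]] x.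
rewrite (_ : (m : E -> R) = fun y => \sum_k c k y * m (b k)); last first.
  by apply/funext => y; rewrite {1}(eb y) linear_sum;
    apply: eq_bigr => k _; rewrite linearZ.
apply: differentiable_continuous; apply: smooth_differentiable.
apply: smooth_sum => k; apply: smoothM; last exact: smooth_cst.
exact: smooth_lin.
Qed.

(** Expanding [L x] along the family [b] turns a derivative in a moving direction into a sum of
    smooth coefficients times derivatives in fixed directions. With [L] a right multiplication it
    gives the smoothness of left-invariant fields. *)
Lemma smooth_derive_linear (F : E -> R) (L : {linear E -> E}) :
  smooth F -> smooth (fun x => 'D_(L x) F x).
Proof.
move=> sF; case: fcE => n [c [b [cc eb]]].
rewrite (_ : (fun x => 'D_(_) F x) = fun x => \sum_k c k (L x) * 'D_(b k) F x).
  apply: smooth_sum => k; apply: smoothM; last exact: smooth_derive.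
  exact/(@smooth_lin _ _ (c k \o L))/finite_coords_continuous.
apply/funext => x; rewrite {1}(eb (L x)) derive_sumr//.
by apply: eq_bigr => k _; rewrite deriveZr.
Qed.

End FiniteCoords.

(** * The Lie algebra of pairs of matrices *)

Section Group.
Variable R : realType.
Implicit Types (x y z : mat R) (p q : U1SU2 R).

Lemma rscaleA a b x : rscale a (rscale b x) = rscale (a * b) x.
Proof. by rewrite /rscale rmorphM scalerA. Qed.

Lemma rscale1 x : rscale 1 x = x.
Proof. by rewrite /rscale rmorph1 scale1r. Qed.

Lemma rscale0 x : rscale 0 x = 0.
Proof. by rewrite /rscale rmorph0 scale0r. Qed.

Lemma rscaler0 a : rscale a (0 : mat R) = 0.
Proof. exact: scaler0. Qed.

Lemma rscaleN1 x : rscale (-1) x = - x.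
Proof. by rewrite /rscale rmorphN1 scaleN1r. Qed.

Lemma rscaleAl a x y : rscale a x * y = rscale a (x * y).
Proof. by congr pair; rewrite /= -scalerAl. Qed.

Lemma rscaleAr a x y : x * rscale a y = rscale a (x * y).
Proof. by congr pair; rewrite /= -scalerAr. Qed.

(* Ring identities restated at [mat R], to keep a single inference path for
   its operations: comparing two paths by conversion is very slow. *)
Lemma mat_mulA x y z : x * (y * z) = x * y * z.
Proof. by congr pair; rewrite /= -!mulmxE mulmxA. Qed.

Lemma mat_mulDr x y z : x * (y + z) = x * y + x * z.
Proof. by congr pair; rewrite /= -!mulmxE mulmxDr. Qed.

Lemma mat_mulBr x y z : x * (y - z) = x * y - x * z.
Proof. by congr pair; rewrite /= -!mulmxE mulmxBr. Qed.

Lemma mat_mul1 x : 1 * x = x.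
Proof. by case: x => a b; congr pair; rewrite /= -mulmxE mul1mx. Qed.

Lemma mat_mul1r x : x * 1 = x.
Proof. by case: x => a b; congr pair; rewrite /= -mulmxE mulmx1. Qed.

Lemma conj_real (a : R) : (a%:C)^* = a%:C :> R[i].
Proof. by apply/CrealP; rewrite complex_real. Qed.

Lemma ge0_complexP (z : R[i]) : 0 <= z -> exists2 d : R, 0 <= d & z = d%:C.
Proof.
case: z => a b; rewrite lecE /= => /andP[/eqP -> a0]; exists a => //.
Qed.

Lemma trmxC_scale n (a : R) (M : 'M[R[i]]_n) :
  (a%:C *: M) ^t* = a%:C *: M ^t*.
Proof. by apply/matrixP => i j; rewrite !mxE rmorphM /= conj_real. Qed.

Lemma trmxCD n (M N : 'M[R[i]]_n) : (M + N) ^t* = M ^t* + N ^t*.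
Proof. by apply/matrixP => i j; rewrite !mxE rmorphD. Qed.

Lemma trmxCN n (M : 'M[R[i]]_n) : (- M) ^t* = - M ^t*.
Proof. by apply/matrixP => i j; rewrite !mxE rmorphN. Qed.

Lemma trmxCM n (M N : 'M[R[i]]_n) : (M *m N) ^t* = N ^t* *m M ^t*.
Proof. by rewrite trmx_mul map_mxM. Qed.

Lemma trmxC1 n : (1%:M : 'M[R[i]]_n) ^t* = 1%:M.
Proof. by rewrite trmx1 map_mx1. Qed.

Lemma lieG_lin a x y : lieG x -> lieG y -> lieG (rscale a x + y).
Proof.
move=> [x1 x2 x3] [y1 y2 y3]; split; rewrite /= ?trmxCD ?trmxC_scale.
- by rewrite x1 y1 scalerN opprD.
- by rewrite x2 y2 scalerN opprD.
- by rewrite mxtraceD mxtraceZ x3 y3 mulr0 addr0.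
Qed.

Lemma lieG0 : lieG (0 : mat R).
Proof. by split; rewrite /= ?trmx0 ?map_mx0 ?oppr0 ?mxtrace0. Qed.

Lemma lieGZ a x : lieG x -> lieG (rscale a x).
Proof. by move=> xG; rewrite -[rscale a x]addr0; exact/lieG_lin/lieG0. Qed.

Definition lie x y : mat R := x * y - y * x.

Lemma lieG_lie x y : lieG x -> lieG y -> lieG (lie x y).
Proof.
move=> [x1 x2 x3] [y1 y2 y3]; split; rewrite /= -?mulmxE ?trmxCD ?trmxCN ?trmxCM.
- by rewrite x1 y1 !mulNmx !mulmxN !opprK opprB.
- by rewrite x2 y2 !mulNmx !mulmxN !opprK opprB.
- by rewrite raddfB /= mxtrace_mulC subrr.
Qed.

Lemma lieSU2_lie x y : lieG x -> lieG y -> lieSU2 (lie x y).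
Proof.
move=> xG yG; split; first exact: lieG_lie.
rewrite /= (mx11_scalar x.1) (mx11_scalar y.1) -!mulmxE -!scalar_mxM.
by rewrite mulrC subrr.
Qed.

Lemma sum_ord2 (V : nmodType) (F : 'I_2 -> V) : \sum_i F i = F 0 + F 1.
Proof.
by rewrite !big_ord_recl big_ord0 addr0; congr (F _ + F _); exact/val_inj.
Qed.

Lemma ord2P (i : 'I_2) : i = 0 \/ i = 1.
Proof. by case: i => -[|[|//]] i2; [left|right]; exact: val_inj. Qed.

Lemma det2 (M : 'M[R[i]]_2) : \det M = M 0 0 * M 1 1 - M 0 1 * M 1 0.
Proof.
rewrite (expand_det_row _ 0) sum_ord2 /cofactor !det_mx11 !mxE /=.
rewrite (_ : lift 0 0 = 1); last exact: val_inj.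
rewrite (_ : lift 1 0 = 0); last exact: val_inj.
by rewrite /= !addn0 add0n expr0 expr1 mul1r mulN1r mulrN.
Qed.

Lemma traceless2 (M : 'M[R[i]]_2) : \tr M = 0 -> M 1 1 = - M 0 0.
Proof. by rewrite /mxtrace sum_ord2 addrC => /eqP; rewrite addr_eq0 => /eqP. Qed.

(** Cayley-Hamilton in size 2 with zero trace. *)
Lemma traceless2_sqr (M : 'M[R[i]]_2) : \tr M = 0 ->
  M *m M = - \det M *: 1%:M.
Proof.
move=> /traceless2 M11; apply/matrixP => i j; rewrite det2 !mxE sum_ord2 M11.
by case: (ord2P i) => ->; case: (ord2P j) => ->; rewrite ?M11 /=; ring.
Qed.

Lemma skewC_entry n (M : 'M[R[i]]_n) i j :
  M ^t* = - M -> M j i = - (M i j)^*.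
Proof. by move=> /matrixP /(_ j i); rewrite !mxE => ->; rewrite opprK. Qed.

Lemma skewC_diag_re n (M : 'M[R[i]]_n) i :
  M ^t* = - M -> complex.Re (M i i) = 0.
Proof.
move=> /(skewC_entry i i); case: (M i i) => a b /= [] /eqP.
by rewrite -subr_eq0 opprK -mulr2n mulrn_eq0 => /eqP.
Qed.

(** A skew-hermitian 1 x 1 matrix is imaginary, and the determinant of [x.2] is a sum of two squared
    moduli. On each factor (a + b x)(a - b x) is thus the scalar a^2 + b^2 d, so points of a conic
    give group elements. *)
Lemma lieG_sqr x : lieG x -> exists d1 d2 : R,
  [/\ 0 <= d1, 0 <= d2, x.1 *m x.1 = - d1%:C *: 1%:M,
      x.2 *m x.2 = - d2%:C *: 1%:M & \det x.2 = d2%:C].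
Proof.
move=> [x1 x2 x3].
have [d1 d1_ge0 ed1] : exists2 d : R, 0 <= d & x.1 0 0 * (x.1 0 0)^* = d%:C.
  exact/ge0_complexP/mul_conjC_ge0.
have M11 := traceless2 x3; have dx := det2 x.2; rewrite M11 in dx.
have [d2 d2_ge0 ed2] : exists2 d : R, 0 <= d & \det x.2 = d%:C.
  apply: ge0_complexP; rewrite dx {2}(skewC_entry 0 0 x2) (skewC_entry 0 1 x2).
  by rewrite !mulrN !opprK addr_ge0// mul_conjC_ge0.
exists d1, d2; split=> //; last by rewrite -ed2 -traceless2_sqr.
rewrite (mx11_scalar x.1) -scalar_mxM -scalemx1; congr (_ *: _).
by rewrite {2}(skewC_entry 0 0 x1) mulrN ed1.
Qed.

Lemma trig_unitary n (M : 'M[R[i]]_n) (a b d : R) :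
  M ^t* = - M -> M *m M = - d%:C *: 1%:M -> a ^+ 2 + b ^+ 2 * d = 1 ->
  a%:C *: 1%:M + b%:C *: M \is unitarymx.
Proof.
move=> sM MM abd; apply/unitarymxP.
rewrite trmxCD !trmxC_scale trmxC1 sM scalerN mulmxDl !mulmxBr.
rewrite -!scalemxAl -!scalemxAr !mul1mx mulmx1 MM !scalerA.
rewrite [b%:C * a%:C]mulrC addrA subrK -scalerBl.
by rewrite mulrN opprK -!rmorphM -rmorphD /= -!expr2 abd scale1r.
Qed.

Lemma trig_in_U1SU2 x (a1 b1 d1 a2 b2 d2 : R) :
  lieG x -> x.1 *m x.1 = - d1%:C *: 1%:M -> x.2 *m x.2 = - d2%:C *: 1%:M ->
  \det x.2 = d2%:C ->
  a1 ^+ 2 + b1 ^+ 2 * d1 = 1 -> a2 ^+ 2 + b2 ^+ 2 * d2 = 1 ->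
  in_U1SU2 (a1%:C *: 1%:M + b1%:C *: x.1, a2%:C *: 1%:M + b2%:C *: x.2).
Proof.
move=> [x1 x2 x3] e1 e2 dx h1 h2; apply/and3P; split=> /=.
- exact: trig_unitary h1.
- exact: trig_unitary h2.
apply/eqP; transitivity (a2%:C ^+ 2 + b2%:C ^+ 2 * \det x.2).
  by rewrite !det2 !mxE /= (traceless2 x3); ring.
by rewrite dx -!rmorphXn -rmorphM -rmorphD h2.
Qed.

End Group.

(** * Rational curves in the group and real coordinates *)

Section Curves.
Variable R : realType.
Implicit Types (x y z : mat R) (p q : U1SU2 R).

Lemma is_diff_scale_cst (E : normedModType R) (k : R -> R) (l : R) (w : E) :
  is_derive (0 : R) 1 k l -> is_diff (0 : R) (fun t => k t *: w) (fun t => t *: (l *: w)).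
Proof.
move=> dk; have kd : differentiable k 0 by exact/derivable1_diffP.
apply: DiffDef; first exact: differentiableZl.
apply/funext => t; rewrite diffZl// diff1E// derive1E (@derive_val _ _ _ _ _ _ _ dk).
by rewrite -scalerA.
Qed.

(* The Cayley parametrization of the unit circle, scaled to have velocity 1. *)
Definition cayley_cos (d t : R) := (1 - d / 4 * t ^+ 2) / (1 + d / 4 * t ^+ 2).
Definition cayley_sin (d t : R) := t / (1 + d / 4 * t ^+ 2).

Lemma cayley_den_neq0 (d t : R) : 0 <= d -> 1 + d / 4 * t ^+ 2 != 0.
Proof.
by move=> d0; rewrite gt_eqF// ltr_pwDl// mulr_ge0 ?divr_ge0 ?sqr_ge0.
Qed.

Lemma cayley_circle (d t : R) : 0 <= d ->
  cayley_cos d t ^+ 2 + cayley_sin d t ^+ 2 * d = 1.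
Proof.
move=> /(cayley_den_neq0 t); rewrite /cayley_cos /cayley_sin => h; field.
(* The side condition of [field] is the nonvanishing of the same denominator multiplied by 4. *)
by apply: contra h => /eqP h; apply/eqP; move: h => /(congr1 ( *%R^~ 4^-1)); lra.
Qed.

Lemma cayley_cos0 d : cayley_cos d 0 = 1.
Proof. by rewrite /cayley_cos expr0n mulr0 subr0 addr0 divr1. Qed.

Lemma cayley_sin0 d : cayley_sin d 0 = 0.
Proof. by rewrite /cayley_sin mul0r. Qed.

Let derive_den (c : R) : is_derive (0 : R) 1 (fun t : R => 1 + c * t ^+ 2) 0.
Proof.
apply: is_derive_eq; rewrite ?fctE /GRing.scale /=; ring.
Qed.

Let derive_den_inv (d : R) :
  is_derive (0 : R) 1 (fun t : R => (1 + d / 4 * t ^+ 2)^-1) 0.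
Proof.
have n0 : 1 + d / 4 * (0 : R) ^+ 2 != 0 by rewrite expr0n mulr0 addr0 oner_neq0.
apply: DeriveDef; first exact/derivableV.
by rewrite deriveV// (@derive_val _ _ _ _ _ _ _ (derive_den _)) scaler0.
Qed.

Lemma derive_cayley_cos d : is_derive (0 : R) 1 (cayley_cos d) 0.
Proof.
have D : is_derive (0 : R) 1 (fun t : R => 1 - d / 4 * t ^+ 2) 0.
  rewrite (_ : (fun t => _) = fun t : R => 1 + (- (d / 4)) * t ^+ 2) //.
  by apply/funext => t; rewrite mulNr.
apply: (@is_derive_eq _ _ _ _ _ _ _ _ (is_deriveM D (derive_den_inv d))).
by rewrite !scaler0 addr0.
Qed.

Lemma derive_cayley_sin d : is_derive (0 : R) 1 (cayley_sin d) 1.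
Proof.
apply: (@is_derive_eq _ _ _ _ _ _ _ _
  (is_deriveM (is_derive_id _ _) (derive_den_inv d))).
by rewrite scaler0 add0r expr0n mulr0 addr0 invr1 scale1r.
Qed.

Lemma coords_lin a x y : coords (rscale a x + y) = a *: coords x + coords y.
Proof.
have reZ (z : R[i]) : complex.Re (a%:C * z) = a * complex.Re z.
  by case: z => u v /=; rewrite mul0r subr0.
have imZ (z : R[i]) : complex.Im (a%:C * z) = a * complex.Im z.
  by case: z => u v /=; rewrite mul0r addr0.
by congr (_, _, (_, _)); apply/matrixP => i j; rewrite !mxE/= raddfD /= ?reZ ?imZ.
Qed.

Lemma coords0 : coords (0 : mat R) = 0.
Proof. by congr (_, _, (_, _)); apply/matrixP => i j; rewrite !mxE. Qed.

Lemma coordsD x y : coords (x + y) = coords x + coords y.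
Proof. by rewrite -[x]rscale1 coords_lin scale1r rscale1. Qed.

Lemma coordsZ a x : coords (rscale a x) = a *: coords x.
Proof. by rewrite -[rscale a x]addr0 coords_lin coords0 addr0. Qed.

Lemma coordsB x y : coords (x - y) = coords x - coords y.
Proof. by rewrite coordsD -rscaleN1 coordsZ scaleN1r. Qed.

Lemma coords_inj : injective (@coords R).
Proof.
move=> [x1 x2] [y1 y2] [] /matrixP r1 /matrixP i1 /matrixP r2 /matrixP i2.
congr pair; apply/matrixP => i j; apply/eqP; rewrite eq_complex.
  by have := r1 i j; have := i1 i j; rewrite !mxE => -> ->; rewrite !eqxx.
by have := r2 i j; have := i2 i j; rewrite !mxE => -> ->; rewrite !eqxx.
Qed.

(** The curve is t -> p (cos t + sin t x) with the Cayley functions for [d1] on the first factor and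
    for [d2] on the second, as the two squares are different scalars in general. Written as scalar
    functions times fixed ambient vectors, it is differentiable because its coefficients are. *)
Lemma tangent_curve p v : tangent p v -> exists g : R -> ambient R,
  [/\ g 0 = coords (sval p), is_diff (0 : R) g (fun t => t *: coords v)
    & forall t, exists q : U1SU2 R, g t = coords (sval q)].
Proof.
move=> [x xG ->]; have [d1 [d2 [d1_ge0 d2_ge0 xx1 xx2 dx]]] := lieG_sqr xG.
pose P := sval p.
pose P1 : mat R := (P.1, 0); pose P2 : mat R := (0, P.2).
pose Q1 : mat R := (P.1 *m x.1, 0); pose Q2 : mat R := (0, P.2 *m x.2).
exists (fun t => (cayley_cos d1 t *: coords P1 + cayley_sin d1 t *: coords Q1) +
                 (cayley_cos d2 t *: coords P2 + cayley_sin d2 t *: coords Q2)).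
split.
- rewrite !cayley_cos0 !cayley_sin0 !scale1r !scale0r !addr0 -coordsD.
  by congr coords; rewrite /P1 /P2 /P; case: (sval p) => a b;
    congr pair; rewrite /= ?addr0 ?add0r.
- have D1 := is_diff_scale_cst (coords P1) (derive_cayley_cos d1).
  have D2 := is_diff_scale_cst (coords Q1) (derive_cayley_sin d1).
  have D3 := is_diff_scale_cst (coords P2) (derive_cayley_cos d2).
  have D4 := is_diff_scale_cst (coords Q2) (derive_cayley_sin d2).
  apply: (@is_diff_eq _ _ _ _ _ _ _ (is_diffD (is_diffD D1 D2) (is_diffD D3 D4))).
  apply/funext => t; rewrite !fctE !scale0r !scaler0 !add0r !scale1r -scalerDr.
  rewrite -coordsD; congr (_ *: coords _).
  by congr pair; rewrite /= ?addr0 ?add0r mulmxE.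
- move=> t.
  have uG := trig_in_U1SU2 xG xx1 xx2 dx (cayley_circle t d1_ge0)
    (cayley_circle t d2_ge0).
  exists (mulG p (exist (@in_U1SU2 R) _ uG)).
  rewrite -!coordsZ -!coordsD; congr coords.
  by congr pair; rewrite /= ?scaler0 ?addr0 ?add0r -mulmxE mulmxDr -!scalemxAr mulmx1.
Qed.

End Curves.

(** * Smooth functions and vector fields on the group *)

Section Fields.
Variable R : realType.
Implicit Types (x y z v w : mat R) (p q : U1SU2 R) (f h : U1SU2 R -> R).
Implicit Types (X Y Z W : U1SU2 R -> mat R) (m : {linear ambient R -> R}).

Lemma finite_coords_ambient : finite_coords (ambient R).
Proof.
by apply: finite_coords_prod; apply: finite_coords_prod;
  exact: finite_coords_mx.
Qed.

(** Linear forms serve as test functions: equalities of vectors, and of brackets, are checked on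
    them. *)
Lemma ambient_form_inj (V W : ambient R) :
  (forall m, m V = m W) -> V = W.
Proof.
case: finite_coords_ambient => n [c [b [_ eb]]] eVW.
by rewrite (eb V) (eb W); apply: eq_bigr => k _; rewrite eVW.
Qed.

Lemma smooth_ambient_lin m : smooth m.
Proof. exact/smooth_lin/finite_coords_continuous/finite_coords_ambient. Qed.

Lemma form_coordsB m x y : m (coords (x - y)) = m (coords x) - m (coords y).
Proof. by rewrite coordsB linearB. Qed.

Definition uncoords (V : ambient R) : mat R :=
  (\matrix_(i, j) (V.1.1 i j +i* V.1.2 i j),
   \matrix_(i, j) (V.2.1 i j +i* V.2.2 i j)).

Lemma uncoordsK V : coords (uncoords V) = V.
Proof.
case: V => [[a b] [c d]].
by congr (_, _, (_, _)); apply/matrixP => i j; rewrite !mxE.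
Qed.

Lemma coordsK x : uncoords (coords x) = x.
Proof. by apply/coords_inj; rewrite uncoordsK. Qed.

(** The left-invariant field p -> p x is the restriction to the group of this linear vector field on
    the ambient space. *)
Definition rmul x (V : ambient R) : ambient R := coords (uncoords V * x).

Lemma rmul_linear x : linear (rmul x).
Proof.
move=> a V W; rewrite /rmul -coords_lin -rscaleAl -mulrDl; congr (coords (_ * _)).
by apply/coords_inj; rewrite coords_lin !uncoordsK.
Qed.

Definition Rmul x := linear_of (rmul_linear x).

Lemma RmulE x y : Rmul x (coords y) = coords (y * x).
Proof. by rewrite /= /rmul coordsK. Qed.

Lemma tangent_lin a p v w : tangent p v -> tangent p w ->
  tangent p (rscale a v + w).
Proof.
move=> [x xG ->] [y yG ->]; exists (rscale a x + y); first exact: lieG_lin.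
by rewrite mulrDr rscaleAr.
Qed.

Lemma tangent_mul p x : lieG x -> tangent p (sval p * x).
Proof. by exists x. Qed.

Lemma tangent0 p : tangent p 0.
Proof. by exists 0; [exact: lieG0 | rewrite mulr0]. Qed.

Lemma tangentZ a p v : tangent p v -> tangent p (rscale a v).
Proof. by move=> tv; rewrite -[rscale a v]addr0; exact/tangent_lin/tangent0. Qed.

Lemma tangentD p v w : tangent p v -> tangent p w -> tangent p (v + w).
Proof. by move=> tv tw; rewrite -[v]rscale1; exact: tangent_lin. Qed.

Lemma tangentB p v w : tangent p v -> tangent p w -> tangent p (v - w).
Proof. by move=> tv tw; rewrite addrC -rscaleN1; exact: tangent_lin. Qed.

(** The extension chosen by [get] and [F] both restrict to [f], hence agree along a curve in the
    group with velocity [v]. *)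
Lemma dirder_extends f F p v : extends f F -> tangent p v ->
  dirder f p v = 'D_(coords v) F (coords (sval p)).
Proof.
move=> fF /tangent_curve [g [g0 dg gG]]; rewrite /dirder.
have [sG eG] : extends f (get [set H | extends f H]) by apply: getPex; exists F.
case: fF => sF eF; apply: (derive_eq_along_curve sG sF g0 dg) => t.
by have [q ->] := gG t; rewrite eG eF.
Qed.

Lemma dirder_linr f p a v w : smoothG f ->
  dirder f p (rscale a v + w) = a * dirder f p v + dirder f p w.
Proof.
move=> [F fF]; rewrite /dirder.
have [sG _] : extends f (get [set H | extends f H]) by apply: getPex; exists F.
by rewrite coords_lin deriveDr// deriveZr.
Qed.

Lemma smoothG_cst (c : R) : smoothG (fun _ : U1SU2 R => c).
Proof. by exists (fun=> c); split=> //; exact: smooth_cst. Qed.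

Lemma dirder_cst (c : R) p v : tangent p v -> dirder (fun=> c) p v = 0.
Proof.
move=> tv; rewrite (@dirder_extends _ (fun=> c))//; first exact: derive_cst.
by split=> //; exact: smooth_cst.
Qed.

Lemma smoothGD f h : smoothG f -> smoothG h -> smoothG (fun p => f p + h p).
Proof.
move=> [F [sF eF]] [H [sH eH]]; exists (fun V => F V + H V).
by split=> [|p]; [exact: smoothD | rewrite eF eH].
Qed.

Lemma smoothGM f h : smoothG f -> smoothG h -> smoothG (fun p => f p * h p).
Proof.
move=> [F [sF eF]] [H [sH eH]]; exists (fun V => F V * H V).
by split=> [|p]; [exact: smoothM | rewrite eF eH].
Qed.

Definition formG m p := m (coords (sval p)).

Lemma extends_formG m : extends (formG m) m.
Proof. by split=> //; exact: smooth_ambient_lin. Qed.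

Lemma smoothG_formG m : smoothG (formG m).
Proof. by exists m; exact: extends_formG. Qed.

Lemma dirder_formG m p v : tangent p v -> dirder (formG m) p v = m (coords v).
Proof.
move=> tv; rewrite (dirder_extends (extends_formG m) tv) derive_lin//.
exact/finite_coords_continuous/finite_coords_ambient.
Qed.

Definition linv x p : mat R := sval p * x.

Lemma vector_field_linv x : lieG x -> vector_field (linv x).
Proof.
move=> xG; split=> [p|f [F fF]]; first exact: tangent_mul.
(* The extension of [f] used here is the one inside [dirder], so at group elements the two
   expressions coincide by definition. *)
exists (fun V => 'D_(Rmul x V) (get [set H | extends f H]) V); split.
  apply: smooth_derive_linear; first exact: finite_coords_ambient.
  by have [] : extends f (get [set H | extends f H]) by apply: getPex; exists F.
by move=> p; rewrite /applyvf /dirder RmulE.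
Qed.

Lemma vector_field_lin f X Y : smoothG f -> vector_field X -> vector_field Y ->
  vector_field (fun p => rscale (f p) (X p) + Y p).
Proof.
move=> sf [tX sX] [tY sY]; split=> [p|h sh]; first exact: tangent_lin.
rewrite (_ : applyvf _ h = fun p => f p * applyvf X h p + applyvf Y h p).
  by apply: smoothGD; [apply: smoothGM => //; exact: sX | exact: sY].
by apply/funext => p; exact: dirder_linr.
Qed.

Lemma vector_field0 : vector_field (fun=> 0 : mat R).
Proof.
have := vector_field_linv (@lieG0 R); rewrite (_ : linv 0 = fun=> 0)//.
by apply/funext => p; rewrite /linv mulr0.
Qed.

Lemma applyvf_formG X m : vector_field X ->
  applyvf X (formG m) = fun p => m (coords (X p)).
Proof. by move=> [tX _]; apply/funext => p; exact: dirder_formG. Qed.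

(** A field applied to the restriction of a linear form returns that form evaluated on the field, so
    its action on such functions determines it. *)
Lemma bracket_unique X Y W W' p : is_bracket X Y W -> is_bracket X Y W' ->
  W p = W' p.
Proof.
move=> [vW bW] [vW' bW']; apply/coords_inj/ambient_form_inj => m.
have := bW _ (smoothG_formG m) p; have := bW' _ (smoothG_formG m) p.
by rewrite (applyvf_formG m vW) (applyvf_formG m vW') => -> ->.
Qed.

Lemma form_rmul_linear m x : linear (fun V => m (rmul x V)).
Proof. by move=> a V W; rewrite rmul_linear linearP. Qed.

Definition form_rmul m x := linear_of (form_rmul_linear m x).

Lemma form_rmulE m x y : form_rmul m x (coords y) = m (coords (y * x)).
Proof. by rewrite /= /rmul coordsK. Qed.

(** Restrictions of linear forms are stable under left-invariant fields, so iterated derivatives of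
    them are again evaluations at matrix products. *)
Lemma linv_formG m x : lieG x -> applyvf (linv x) (formG m) = formG (form_rmul m x).
Proof.
move=> xG; rewrite (applyvf_formG m (vector_field_linv xG)).
by apply/funext => p; rewrite /formG form_rmulE.
Qed.

Lemma linv_linv_formG m x y p : lieG x -> lieG y ->
  applyvf (linv x) (applyvf (linv y) (formG m)) p = m (coords (sval p * x * y)).
Proof.
move=> xG yG; rewrite (linv_formG m yG) (linv_formG (form_rmul m y) xG).
by rewrite /formG !form_rmulE.
Qed.

(* Testing against restrictions of linear forms suffices, since these have no
   second derivatives: the symmetry of second derivatives is not needed. *)
Lemma bracket_linv x y W p : lieG x -> lieG y ->
  is_bracket (linv x) (linv y) W -> W p = linv (lie x y) p.
Proof.
move=> xG yG [vW bW]; apply/coords_inj/ambient_form_inj => m.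
have := bW _ (smoothG_formG m) p.
rewrite (linv_linv_formG m p xG yG) (linv_linv_formG m p yG xG).
rewrite (applyvf_formG m vW) => ->; rewrite -form_coordsB.
by rewrite /linv /lie mat_mulBr !mat_mulA.
Qed.

End Fields.

(** * Metrics and ad-invariance *)

Section Metric.
Variables (R : realType) (g : U1SU2 R -> mat R -> mat R -> R).
Hypothesis gR : riemannian g.
Implicit Types (u v w x y z : mat R) (p q : U1SU2 R).

Lemma metricC p v w : tangent p v -> tangent p w -> g p v w = g p w v.
Proof. by case: gR => + _ _ _; apply. Qed.

Lemma metric_linl p a u v w : tangent p u -> tangent p v -> tangent p w ->
  g p (rscale a u + v) w = a * g p u w + g p v w.
Proof. by case: gR => _ + _ _; apply. Qed.

Lemma metric_linr p a u v w : tangent p u -> tangent p v -> tangent p w ->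
  g p w (rscale a u + v) = a * g p w u + g p w v.
Proof.
move=> tu tv tw; rewrite metricC//; last exact: tangent_lin.
by rewrite metric_linl// !(metricC tw).
Qed.

Lemma metricDl p u v w : tangent p u -> tangent p v -> tangent p w ->
  g p (u + v) w = g p u w + g p v w.
Proof. by move=> tu tv tw; rewrite -{1}[u]rscale1 metric_linl// mul1r. Qed.

Lemma metricDr p u v w : tangent p u -> tangent p v -> tangent p w ->
  g p w (u + v) = g p w u + g p w v.
Proof. by move=> tu tv tw; rewrite -{1}[u]rscale1 metric_linr// mul1r. Qed.

Lemma metric0l p w : tangent p w -> g p 0 w = 0.
Proof.
move=> tw; have t0 := tangent0 p.
have := metricDl t0 t0 tw; rewrite addr0 => /eqP.
by rewrite -subr_eq0 opprD addrA subrr sub0r oppr_eq0 => /eqP.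
Qed.

Lemma metricZl p a u w : tangent p u -> tangent p w ->
  g p (rscale a u) w = a * g p u w.
Proof.
move=> tu tw; rewrite -[rscale a u]addr0 metric_linl//; last exact: tangent0.
by rewrite metric0l// addr0.
Qed.

Lemma metricZr p a u w : tangent p u -> tangent p w ->
  g p w (rscale a u) = a * g p w u.
Proof.
by move=> tu tw; rewrite metricC ?metricZl// ?(metricC tw)//; exact: tangentZ.
Qed.

Lemma metricBl p u v w : tangent p u -> tangent p v -> tangent p w ->
  g p (u - v) w = g p u w - g p v w.
Proof.
move=> tu tv tw; rewrite addrC -rscaleN1 metric_linl//.
by rewrite mulN1r addrC.
Qed.

Lemma metricBr p u v w : tangent p u -> tangent p v -> tangent p w ->
  g p w (u - v) = g p w u - g p w v.
Proof.
by move=> tu tv tw; rewrite metricC ?metricBl ?(metricC tw)//; exact: tangentB.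
Qed.

Lemma metric_gt0 p v : tangent p v -> v != 0 -> 0 < g p v v.
Proof. by case: gR => _ _ + _; apply. Qed.

Lemma metric_eq0 p v : tangent p v -> g p v v = 0 -> v = 0.
Proof.
move=> tv gv0; apply/eqP; apply: contraT => /(metric_gt0 tv).
by rewrite gv0 ltxx.
Qed.

Lemma metric_nondeg p v w : tangent p v -> tangent p w ->
  (forall z, tangent p z -> g p v z = g p w z) -> v = w.
Proof.
move=> tv tw e; suff /eqP : v - w = 0 by rewrite subr_eq0 => /eqP.
apply: (@metric_eq0 p); first exact: tangentB.
by rewrite metricBl ?e ?subrr//; exact: tangentB.
Qed.

End Metric.

(** * Skewness of ad for a bi-invariant metric *)

Section AdInvariance.
Variables (R : realType).
Implicit Types (u v w x y z : mat R) (p q : U1SU2 R).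

Lemma tangent1 x : tangent (oneG R) x <-> lieG x.
Proof.
split=> [[y yG ->]|xG]; first by rewrite /= mat_mul1.
by exists x => //; rewrite /= mat_mul1.
Qed.

Lemma mulG1 p : mulG p (oneG R) = p.
Proof.
case: p => p pG; apply/eq_exist; exact: mat_mul1r.
Qed.

Lemma mul1G p : mulG (oneG R) p = p.
Proof.
case: p => p pG; apply/eq_exist; exact: mat_mul1.
Qed.

Lemma left_invariant_linv (g : U1SU2 R -> mat R -> mat R -> R) x y p :
  left_invariant g -> lieG x -> lieG y ->
  g p (linv x p) (linv y p) = g (oneG R) x y.
Proof.
move=> gL /tangent1 x1 /tangent1 y1.
by have := gL p _ _ _ x1 y1; rewrite mulG1.
Qed.

Lemma lieSU2_lin a x y : lieSU2 x -> lieSU2 y -> lieSU2 (rscale a x + y).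
Proof.
move=> [xG x1] [yG y1]; split; first exact: lieG_lin.
by rewrite /= x1 y1 scaler0 addr0.
Qed.

Lemma lieSU2Z a x : lieSU2 x -> lieSU2 (rscale a x).
Proof.
by move=> [xG x1]; split; [exact: lieGZ | rewrite /= x1 scaler0].
Qed.

Lemma lieSU2N x : lieSU2 x -> lieSU2 (- x).
Proof. by rewrite -rscaleN1; exact: lieSU2Z. Qed.

(** The part of (1 + x) y (1 - x) that is even in x; the odd part is [lie x y]. *)
Definition sandwich x y : mat R := y - x * y * x.

Lemma lieSU2_sandwich x y : lieSU2 x -> lieSU2 y -> lieSU2 (sandwich x y).
Proof.
move=> [[x1 x2 x3] x0] [[y1 y2 y3] y0]; split; last first.
  by rewrite /= x0 y0 -mulmxE mulmx0 subr0.
split; rewrite /= -?mulmxE ?trmxCD ?trmxCN ?trmxCM.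
- by rewrite x1 y1 !(mulNmx, mulmxN) !opprK mulmxA opprB addrC.
- by rewrite x2 y2 !(mulNmx, mulmxN) !opprK mulmxA opprB addrC.
- rewrite raddfB /= y3 mxtrace_mulC mulmxA (traceless2_sqr x3).
  by rewrite -scalemxAl mul1mx mxtraceZ y3 mulr0 subrr.
Qed.

Section BiInvariant.
Variable g : U1SU2 R -> mat R -> mat R -> R.
Hypotheses (gR : riemannian g) (gI : bi_invariant g).
Let g1 := g (oneG R).

(** Conjugation is a right translation by [p'], the inverse of [p], followed by the left translation
    by [p]. *)
Lemma Ad_invariant p p' y z : mulG p' p = oneG R -> mulG p p' = oneG R ->
  lieG y -> lieG z ->
  lieG (sval p * y * sval p') -> lieG (sval p * z * sval p') ->
  g1 (sval p * y * sval p') (sval p * z * sval p') = g1 y z.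
Proof.
move=> p'p pp' yG zG pyG pzG; case: gI => gL gRi.
(* Tangency at [p'] holds because w p' = p' (p w p'). *)
have tp w : lieG (sval p * w * sval p') -> tangent p' (w * sval p').
  move=> wG; exists (sval p * w * sval p') => //.
  by rewrite !mat_mulA -[sval p' * sval p]/(sval (mulG p' p)) p'p /= mat_mul1.
have := gL p p' _ _ (tp y pyG) (tp z pzG); rewrite pp' !mat_mulA /g1 => ->.
have t1 w : lieG w -> tangent (oneG R) w by move=> wG; exact/tangent1.
by have := gRi p' (oneG R) _ _ (t1 y yG) (t1 z zG); rewrite mul1G.
Qed.

Lemma cayley_factor n (s : R) (M : 'M[R[i]]_n) :
  s%:C *: 1%:M + s%:C *: M = s%:C *: (1%:M + M) /\
  s%:C *: 1%:M + (- s)%:C *: M = s%:C *: (1%:M - M).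
Proof. by rewrite rmorphN scaleNr scalerDr scalerBr. Qed.

Lemma cayley_conj n (M Y : 'M[R[i]]_n) :
  (1%:M + M) *m Y *m (1%:M - M) = Y - M *m Y *m M + (M *m Y - Y *m M).
Proof.
rewrite mulmxDl mul1mx mulmxBr mulmx1 mulmxDl opprD.
by rewrite [- (Y *m M) - _]addrC addrACA.
Qed.

(* The group element (1 + x) / sqrt(1 + det x) acts by Ad as
   y |-> (y + [x, y] - x y x) / (1 + det x); comparing x with -x isolates the
   derivative. *)
Lemma Ad_cayley x y z : lieSU2 x -> lieSU2 y -> lieSU2 z ->
  g1 (sandwich x y + lie x y) z = g1 y (sandwich x z - lie x z).
Proof.
move=> [xG x0] yS zS.
have [d1 [d [_ d_ge0 e1 e2 dx]]] := lieG_sqr xG.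
pose s := (Num.sqrt (1 + d))^-1.
have d1_gt0 : 0 < 1 + d by rewrite ltr_pwDl.
have ss : s * s * (1 + d) = 1.
  rewrite /s -invfM -expr2 sqr_sqrtr ?mulVf ?gt_eqF//; exact: ltW.
(* The coefficients 1, 0 make the U(1) component trivial; [s], [s] and [s], [- s] give the Cayley
   element of [x.2] and its inverse. *)
have circle0 : 1 ^+ 2 + 0 ^+ 2 * d1 = 1 :> R by ring.
have circle1 : s ^+ 2 + s ^+ 2 * d = 1 by rewrite -ss; ring.
have circle2 : s ^+ 2 + (- s) ^+ 2 * d = 1 by rewrite -ss; ring.
pose p : U1SU2 R :=
  exist (@in_U1SU2 R) _ (trig_in_U1SU2 xG e1 e2 dx circle0 circle1).
pose p' : U1SU2 R :=
  exist (@in_U1SU2 R) _ (trig_in_U1SU2 xG e1 e2 dx circle0 circle2).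
have one1 : (1 : R)%:C *: 1%:M + (0 : R)%:C *: x.1 = 1%:M.
  by rewrite x0 scaler0 addr0 scale1r.
have [f1 f2] := cayley_factor s x.2.
have ssC : s%:C * s%:C * (1 + d%:C) = 1 :> R[i].
  by rewrite -(rmorph1 (@real_complex R)) -rmorphD -!rmorphM /= ss.
have unit_scale : s%:C *: (s%:C *: ((1 + d%:C) *: 1%:M)) = 1%:M :> 'M[R[i]]_2.
  by rewrite !scalerA ssC scale1r.
have xx : (1%:M + x.2) *m (1%:M - x.2) = (1 + d%:C) *: 1%:M.
  rewrite mulmxDl mulmxBr !mul1mx mulmxBr mulmx1 e2 addrA subrK.
  by rewrite scaleNr opprK scalerDl scale1r.
have xx' : (1%:M - x.2) *m (1%:M + x.2) = (1 + d%:C) *: 1%:M.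
  rewrite mulmxBl mulmxDr !mul1mx mulmxDr mulmx1 e2 opprD addrA addrK.
  by rewrite scaleNr opprK scalerDl scale1r.
have pp' : mulG p p' = oneG R.
  apply/eq_exist; congr pair; rewrite /= ?one1 -?mulmxE ?mulmx1//.
  by rewrite f1 f2 -scalemxAl -scalemxAr xx.
have p'p : mulG p' p = oneG R.
  apply/eq_exist; congr pair; rewrite /= ?one1 -?mulmxE ?mulmx1//.
  by rewrite f1 f2 -scalemxAl -scalemxAr xx'.
have conj w : lieSU2 w ->
    sval p * w * sval p' = rscale (s * s) (sandwich x w + lie x w).
  move=> [_ w0]; congr pair; rewrite /= ?one1 -?mulmxE.
    by rewrite w0 x0 !(mulmx0, mul0mx, mulmx1) subrr !(addr0, oppr0, subr0) scaler0.
  rewrite f1 f2 -!scalemxAl -scalemxAr cayley_conj scalerA.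
  by rewrite rmorphM.
have conj' w : lieSU2 w ->
    sval p' * w * sval p = rscale (s * s) (sandwich x w - lie x w).
  move=> [_ w0]; congr pair; rewrite /= ?one1 -?mulmxE.
    by rewrite w0 x0 !(mulmx0, mul0mx, mulmx1) !subr0 scaler0.
  have := cayley_conj (- x.2) w.2; rewrite opprK => cx.
  rewrite f1 f2 -!scalemxAl -scalemxAr cx scalerA.
  rewrite rmorphM !(mulNmx, mulmxN) !opprK; congr (_ *: (_ + _)).
  by rewrite opprB addrC.
have xS : lieSU2 x by [].
have SG w : lieSU2 w -> lieG w by case.
have cG w : lieSU2 w -> lieSU2 (rscale (s * s) (sandwich x w + lie x w)).
  move=> wS; apply/lieSU2Z; rewrite -[sandwich x w]rscale1; apply: lieSU2_lin.
    exact: lieSU2_sandwich.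
  exact: (lieSU2_lie xG (SG _ wS)).
have cG' w : lieSU2 w -> lieSU2 (rscale (s * s) (sandwich x w - lie x w)).
  move=> wS; apply/lieSU2Z; rewrite addrC -rscaleN1; apply: lieSU2_lin.
    exact: (lieSU2_lie xG (SG _ wS)).
  exact: lieSU2_sandwich.
have zS' := cG' _ zS.
(* Invariance is applied to the pair y, p' z p, which moves conjugation by [p] on one argument to
   conjugation by [p'] on the other. *)
have back : sval p * (sval p' * z * sval p) * sval p' = z.
  rewrite !mat_mulA -[sval p * sval p']/(sval (mulG p p')) pp' mat_mul1.
  by rewrite -mat_mulA -[sval p * sval p']/(sval (mulG p p')) pp' mat_mul1r.
have t1 w : lieSU2 w -> tangent (oneG R) w by move=> [wG _]; exact/tangent1.
have := @Ad_invariant p p' y (sval p' * z * sval p) p'p pp'.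
rewrite back (conj y yS) (conj' z zS).
move=> /(_ (SG _ yS) (SG _ zS') (SG _ (cG _ yS)) (SG _ zS)).
have tl w : lieSU2 w -> tangent (oneG R) (sandwich x w + lie x w).
  move=> wS; apply/tangentD; first exact/t1/lieSU2_sandwich.
  exact/t1/(lieSU2_lie xG (SG _ wS)).
have tl' w : lieSU2 w -> tangent (oneG R) (sandwich x w - lie x w).
  move=> wS; apply/tangentB; first exact/t1/lieSU2_sandwich.
  exact/t1/(lieSU2_lie xG (SG _ wS)).
rewrite /g1 (metricZl gR _ (tl y yS) (t1 z zS)) (metricZr gR _ (tl' z zS) (t1 y yS)).
apply: mulfI; apply: contra_eq_neq ss => ->.
by rewrite mul0r eq_sym oner_neq0.
Qed.

Lemma ad_skew x y z : lieSU2 x -> lieSU2 y -> lieSU2 z ->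
  g1 (lie x y) z = - g1 y (lie x z).
Proof.
move=> xS yS zS.
have tS w : lieSU2 w -> tangent (oneG R) w by move=> [wG _]; exact/tangent1.
have [xG yG zG] : [/\ lieG x, lieG y & lieG z] by split; [case: xS|case: yS|case: zS].
have lS v w : lieG v -> lieG w -> tangent (oneG R) (lie v w).
  by move=> vG wG; exact/tangent1/lieG_lie.
have := Ad_cayley xS yS zS; have := Ad_cayley (lieSU2N xS) yS zS.
have sN w : sandwich (- x) w = sandwich x w.
  by congr pair; rewrite /= -?mulmxE !mulNmx mulmxN opprK.
have lN w : lie (- x) w = - lie x w.
  by congr pair; rewrite /= -?mulmxE mulNmx mulmxN opprB opprK addrC.
have sS w : lieSU2 w -> tangent (oneG R) (sandwich x w).
  by move=> wS; exact/tS/lieSU2_sandwich.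
rewrite !sN !lN opprK /g1.
rewrite (metricBl gR (sS _ yS) (lS _ _ xG yG) (tS _ zS)).
rewrite (metricDl gR (sS _ yS) (lS _ _ xG yG) (tS _ zS)).
rewrite (metricBr gR (sS _ zS) (lS _ _ xG zG) (tS _ yS)).
rewrite (metricDr gR (sS _ zS) (lS _ _ xG zG) (tS _ yS)).
have alg (a b c d : R) : a - b = c + d -> a + b = c - d -> b = - d by lra.
exact: alg.
Qed.

End BiInvariant.
End AdInvariance.

(** * Structure constants of su(2) *)

Section SU2Basis.
Variables (R : realType).
Implicit Types (u v w x y z : mat R).

(** Three real parameters determining an element of su(2). They supply the dimension count by which
    three orthonormal vectors span. *)
Definition su2_coord (x : mat R) : 'rV[R]_3 :=
  \row_j [:: complex.Im (x.2 0 0); complex.Re (x.2 0 1); complex.Im (x.2 0 1)]`_j.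

Lemma su2_coord_lin a x y :
  su2_coord (rscale a x + y) = a *: su2_coord x + su2_coord y.
Proof.
have reZ (z w : R[i]) : complex.Re (a%:C * z + w) = a * complex.Re z + complex.Re w.
  by case: z w => [b c] [d e] /=; rewrite mul0r subr0.
have imZ (z w : R[i]) : complex.Im (a%:C * z + w) = a * complex.Im z + complex.Im w.
  by case: z w => [b c] [d e] /=; rewrite mul0r addr0.
apply/rowP => -[j j3]; rewrite !mxE /=.
by case: j j3 => [|[|[|//]]] j3 /=; rewrite ?reZ ?imZ.
Qed.

Lemma su2_coordZ a x : su2_coord (rscale a x) = a *: su2_coord x.
Proof.
have c0 : su2_coord 0 = 0.
  by apply/rowP => -[[|[|[|//]]] j3]; rewrite !mxE /= ?mxE.
by rewrite -[rscale a x]addr0 su2_coord_lin c0 addr0.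
Qed.

Lemma su2_coord_inj x y : lieSU2 x -> lieSU2 y ->
  su2_coord x = su2_coord y -> x = y.
Proof.
move=> [[_ x2 x3] x0] [[_ y2 y3] y0] /rowP e.
have /= := e 0; have /= := e 1; have /= := e (inord 2).
rewrite !mxE /= inordK//= => i01 r01 i00.
have e00 : x.2 0 0 = y.2 0 0.
  by apply/eqP; rewrite eq_complex !skewC_diag_re// i00 !eqxx.
have e01 : x.2 0 1 = y.2 0 1 by apply/eqP; rewrite eq_complex r01 i01 !eqxx.
suff e2 : x.2 = y.2 by case: x y x0 y0 e2 {x2 x3 y2 y3 e i01 r01 i00 e00 e01} =>
  [? ?] [? ?] /= -> -> ->.
apply/matrixP => i j; case: (ord2P i) => ->; case: (ord2P j) => ->//.
  by rewrite (skewC_entry 0 1 x2) (skewC_entry 0 1 y2) e01.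
by rewrite (traceless2 x3) (traceless2 y3) e00.
Qed.

Lemma lie_xx x : lie x x = 0.
Proof. by congr pair; rewrite /= subrr. Qed.

Lemma lieC x y : lie y x = - lie x y.
Proof. by congr pair; rewrite /= opprB. Qed.

Lemma lie_linl a x y z : lie (rscale a x + y) z = rscale a (lie x z) + lie y z.
Proof.
by congr pair; rewrite /= -?mulmxE mulmxDl mulmxDr -scalemxAl -scalemxAr
  scalerBr opprD addrACA.
Qed.

Lemma lie_linr a x y z : lie z (rscale a x + y) = rscale a (lie z x) + lie z y.
Proof.
by congr pair; rewrite /= -?mulmxE mulmxDl mulmxDr -scalemxAl -scalemxAr
  scalerBr opprD addrACA.
Qed.

Lemma lieZl a x z : lie (rscale a x) z = rscale a (lie x z).
Proof. by congr pair; rewrite /= -?mulmxE -scalemxAl -scalemxAr scalerBr. Qed.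

Lemma lieZr a x z : lie z (rscale a x) = rscale a (lie z x).
Proof. by congr pair; rewrite /= -?mulmxE -scalemxAl -scalemxAr scalerBr. Qed.

(** Excludes a vanishing structure constant. The witnesses [A] and [B] are i sigma_3 and i sigma_2
    for the Pauli matrices, and the upper right entry of their commutator is 2i. *)
Lemma su2_nonabelian : exists x y, [/\ lieSU2 x, lieSU2 y & lie x y != 0].
Proof.
pose A : 'M[R[i]]_2 := \matrix_(i, j) (if i != j then 0 else if i == 0 then 'i else - 'i).
pose B : 'M[R[i]]_2 := \matrix_(i, j) (if i == j then 0 else if i == 0 then 1 else -1).
exists (0, A), (0, B).
have tr2 (M : 'M[R[i]]_2) : M 1 1 = - M 0 0 -> \tr M = 0.
  by move=> M11; rewrite /mxtrace sum_ord2 M11 addrN.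
split.
- split=> //; split; rewrite /= ?trmx0 ?map_mx0 ?oppr0//.
    apply/matrixP => i j; rewrite !mxE.
    by case: (ord2P i) => ->; case: (ord2P j) => -> /=;
      rewrite ?rmorphN ?rmorph0 /= ?conjCi ?opprK ?oppr0.
  by apply: tr2; rewrite !mxE.
- split=> //; split; rewrite /= ?trmx0 ?map_mx0 ?oppr0//.
    apply/matrixP => i j; rewrite !mxE.
    by case: (ord2P i) => ->; case: (ord2P j) => -> /=;
      rewrite ?rmorphN ?rmorph0 ?rmorph1 ?opprK ?oppr0.
  by apply: tr2; rewrite !mxE oppr0.
apply/eqP => /(congr1 (fun x : mat R => x.2 0 1)); rewrite /= -!mulmxE !mxE.
rewrite !sum_ord2 !mxE /= !(mulr0, mul0r, addr0, add0r, mulr1, mul1r).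
rewrite opprK -mulr2n => /eqP; rewrite mulrn_eq0 /= => /eqP[] /eqP.
by rewrite oner_eq0.
Qed.

Section Orthonormal.
Variables (g : U1SU2 R -> mat R -> mat R -> R).
Hypotheses (gR : riemannian g).
Let g1 := g (oneG R).
Variables (u0 u1 u2 : mat R).
Hypotheses (uS0 : lieSU2 u0) (uS1 : lieSU2 u1) (uS2 : lieSU2 u2).
Hypotheses (o00 : g1 u0 u0 = 1) (o11 : g1 u1 u1 = 1) (o22 : g1 u2 u2 = 1).
Hypotheses (o01 : g1 u0 u1 = 0) (o02 : g1 u0 u2 = 0) (o12 : g1 u1 u2 = 0).

Definition comb3 a b c := rscale a u0 + (rscale b u1 + rscale c u2).

Let tS x : lieSU2 x -> tangent (oneG R) x.
Proof. by move=> [xG _]; exact/tangent1. Qed.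

Lemma lieSU2_comb3 a b c : lieSU2 (comb3 a b c).
Proof. by apply/lieSU2_lin/lieSU2_lin/lieSU2Z. Qed.

Lemma metric_comb3 a b c x : lieSU2 x ->
  g1 (comb3 a b c) x = a * g1 u0 x + b * g1 u1 x + c * g1 u2 x.
Proof.
move=> xS; have xt := tS xS.
rewrite /g1 /comb3 (metric_linl gR _ (tS uS0) _ xt); last first.
  by apply/tS/lieSU2_lin/lieSU2Z.
rewrite (metric_linl gR _ (tS uS1) _ xt); last exact/tS/lieSU2Z.
by rewrite (metricZl gR _ (tS uS2) xt) addrA.
Qed.

Lemma comb3_coord a b c :
  [/\ g1 (comb3 a b c) u0 = a, g1 (comb3 a b c) u1 = b & g1 (comb3 a b c) u2 = c].
Proof.
have o10 : g1 u1 u0 = 0 by rewrite /g1 (metricC gR)//; exact: tS.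
have o20 : g1 u2 u0 = 0 by rewrite /g1 (metricC gR)//; exact: tS.
have o21 : g1 u2 u1 = 0 by rewrite /g1 (metricC gR)//; exact: tS.
rewrite !metric_comb3// o00 o11 o22 o01 o02 o12 o10 o20 o21.
by rewrite !(mulr0, mulr1, addr0, add0r).
Qed.

(** If a combination has zero coordinates, its inner products with the basis vanish, and these are
    its coefficients. The 3 x 3 matrix of coordinates is therefore invertible, and its inverse
    provides coefficients for any [x]. *)
Lemma comb3_span x : lieSU2 x -> x = comb3 (g1 x u0) (g1 x u1) (g1 x u2).
Proof.
move=> xS; suff [a [b [c ->]]] : exists a b c, x = comb3 a b c.
  by have [-> -> ->] := comb3_coord a b c.
have coord_comb3 a b c : su2_coord (comb3 a b c) =
    a *: su2_coord u0 + (b *: su2_coord u1 + c *: su2_coord u2).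
  by rewrite /comb3 !su2_coord_lin su2_coordZ.
pose U : 'M[R]_3 := \matrix_i su2_coord ([:: u0; u1; u2]`_i).
have mulU (v : 'rV[R]_3) :
    v *m U = su2_coord (comb3 (v 0 0) (v 0 1) (v 0 (inord 2))).
  rewrite coord_comb3 mulmx_sum_row !big_ord_recl big_ord0 addr0 !rowK /=.
  congr (_ *: _ + (_ *: _ + _ *: _)); congr (v 0 _); apply/val_inj => //=.
  by rewrite inordK.
have Uu : U \in unitmx.
  rewrite -row_free_unit; apply: inj_row_free => v.
  rewrite mulU => v0.
  have c0 : comb3 (v 0 0) (v 0 1) (v 0 (inord 2)) = comb3 0 0 0.
    apply: su2_coord_inj; [exact: lieSU2_comb3|exact: lieSU2_comb3|].
    by apply: (etrans v0); rewrite coord_comb3 !scale0r !addr0.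
  have [a1 a2 a3] := comb3_coord (v 0 0) (v 0 1) (v 0 (inord 2)).
  have [b1 b2 b3] := comb3_coord 0 0 0; move: a1 a2 a3.
  rewrite c0 b1 b2 b3 => a1 a2 a3; apply/rowP => -[[|[|[|//]]] j3]; rewrite mxE.
  - by rewrite a1; congr (v 0 _); exact/val_inj.
  - by rewrite a2; congr (v 0 _); exact/val_inj.
  - by rewrite a3; congr (v 0 _); apply/val_inj; rewrite /= inordK.
pose v := su2_coord x *m invmx U.
exists (v 0 0), (v 0 1), (v 0 (inord 2)).
apply: su2_coord_inj => //; first exact: lieSU2_comb3.
by rewrite -mulU /v -mulmxA mulVmx// mulmx1.
Qed.

Hypothesis gI : bi_invariant g.

(** By skewness of ad the trilinear form g1([x, y], z) is alternating, so each bracket has a single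
    component, and all three components equal c = g1([u0, u1], u2). If c were 0, all brackets in
    su(2) would vanish. *)
Lemma su2_structure : exists2 c : R, c != 0 &
  [/\ lie u0 u1 = rscale c u2, lie u1 u2 = rscale c u0 & lie u2 u0 = rscale c u1].
Proof.
have SG x : lieSU2 x -> lieG x by case.
have lS x y : lieSU2 x -> lieSU2 y -> lieSU2 (lie x y).
  by move=> /SG xG /SG yG; exact: lieSU2_lie.
have skew x y z : lieSU2 x -> lieSU2 y -> lieSU2 z ->
    g1 (lie x y) z = - g1 (lie x z) y.
  move=> xS yS zS; apply: (etrans (ad_skew gR gI xS yS zS)); congr (- _).
  by apply: (metricC gR); apply/tS => //; exact: lS.
have asym x y z : lieSU2 x -> lieSU2 y -> lieSU2 z ->
    g1 (lie x y) z = - g1 (lie y x) z.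
  move=> xS yS zS; rewrite lieC -rscaleN1 /g1 (metricZl gR) ?mulN1r//; apply/tS => //.
  exact: lS.
have diag x y : lieSU2 x -> lieSU2 y -> g1 (lie x y) y = 0.
  by move=> xS yS; have := skew _ _ _ xS yS yS; lra.
have diag' x y : lieSU2 x -> lieSU2 y -> g1 (lie x y) x = 0.
  by move=> xS yS; rewrite asym// diag// oppr0.
pose c := g1 (lie u0 u1) u2.
have c1 : g1 (lie u1 u2) u0 = c by rewrite skew// asym// opprK.
have c2 : g1 (lie u2 u0) u1 = c by rewrite skew// asym// opprK c1.
have h01 : lie u0 u1 = rscale c u2.
  rewrite (comb3_span (lS _ _ uS0 uS1)) (diag _ _ uS0 uS1) (diag' _ _ uS0 uS1).
  by rewrite /comb3 !rscale0 !add0r.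
have h12 : lie u1 u2 = rscale c u0.
  rewrite (comb3_span (lS _ _ uS1 uS2)) (diag _ _ uS1 uS2) (diag' _ _ uS1 uS2).
  by rewrite /comb3 !rscale0 !addr0 c1.
have h20 : lie u2 u0 = rscale c u1.
  rewrite (comb3_span (lS _ _ uS2 uS0)) (diag _ _ uS2 uS0) (diag' _ _ uS2 uS0).
  by rewrite /comb3 !rscale0 addr0 add0r c2.
exists c => //; apply/eqP => c0.
have [x [y [xS yS /eqP[]]]] := su2_nonabelian.
have l0 (a b : mat R) : lie a b = 0 -> lie b a = 0.
  by move=> ab0; rewrite lieC ab0 oppr0.
have z01 : lie u0 u1 = 0 by rewrite h01 c0 rscale0.
have z12 : lie u1 u2 = 0 by rewrite h12 c0 rscale0.
have z20 : lie u2 u0 = 0 by rewrite h20 c0 rscale0.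
have combl a b d z : lie u0 z = 0 -> lie u1 z = 0 -> lie u2 z = 0 ->
    lie (comb3 a b d) z = 0.
  move=> e0 e1 e2; rewrite /comb3 !lie_linl lieZl e0 e1 e2.
  by rewrite !rscaler0 !addr0.
have y0 : lie y u0 = 0.
  rewrite (comb3_span yS); exact: (combl _ _ _ _ (lie_xx u0) (l0 _ _ z01) z20).
have y1 : lie y u1 = 0.
  rewrite (comb3_span yS); exact: (combl _ _ _ _ z01 (lie_xx u1) (l0 _ _ z12)).
have y2 : lie y u2 = 0.
  rewrite (comb3_span yS); exact: (combl _ _ _ _ (l0 _ _ z20) z12 (lie_xx u2)).
rewrite (comb3_span xS).
exact: (combl _ _ _ _ (l0 _ _ y0) (l0 _ _ y1) (l0 _ _ y2)).
Qed.

End Orthonormal.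
End SU2Basis.

(** * The factors u(1) and su(2) *)

Section U1Part.
Variable R : realType.
Implicit Types (w x z : mat R).

Definition u1_part x : mat R := (x.1, 0).
Definition su2_part x : mat R := (0, x.2).

Lemma partE x : x = u1_part x + su2_part x.
Proof. by case: x => a b; congr pair; rewrite /= ?addr0 ?add0r. Qed.

Lemma lieU1_part x : lieG x -> lieU1 (u1_part x).
Proof.
by move=> [x1 _ _]; split=> //; split; rewrite /= ?trmx0 ?map_mx0 ?oppr0 ?mxtrace0.
Qed.

Lemma lieSU2_part x : lieG x -> lieSU2 (su2_part x).
Proof. by move=> [_ x2 x3]; split=> //; split; rewrite /= ?trmx0 ?map_mx0 ?oppr0. Qed.

Lemma lieU1_line z w : lieU1 z -> z != 0 -> lieU1 w -> exists a, w = rscale a z.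
Proof.
move=> [[z1 _ _] z2] z0 [[w1 _ _] w2].
have iz : complex.Im (z.1 0 0) != 0.
  apply: contra z0 => /eqP iz; apply/eqP.
  case: z z1 z2 iz => a b /= a1 -> iz; congr pair; apply/matrixP => i j.
  by rewrite !ord1 mxE; apply/eqP; rewrite eq_complex skewC_diag_re// iz eqxx.
exists (complex.Im (w.1 0 0) / complex.Im (z.1 0 0)).
case: w w1 w2 => c d /= c1 ->; rewrite /rscale; congr pair; last first.
  by rewrite /= z2 scaler0.
apply/matrixP => i j; rewrite !ord1 mxE; apply/eqP.
have := skewC_diag_re 0 c1; have := skewC_diag_re 0 z1; case: (c 0 0) => p q; case: (z.1 0 0) iz => r t.
by rewrite eq_complex /= => t0 -> ->; rewrite !(mul0r, mulr0, subr0, addr0, eqxx) /= divfK.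
Qed.

Lemma lieU1_central z x : z.2 = 0 -> lie z x = 0.
Proof.
move=> z2; congr pair; rewrite /= -?mulmxE.
  by rewrite (mx11_scalar z.1) (mx11_scalar x.1) -!scalar_mxM mulrC subrr.
by rewrite z2 mul0mx mulmx0 subrr.
Qed.

Lemma su2_partD x z : su2_part (x + z) = su2_part x + su2_part z.
Proof. by congr pair; rewrite /= addr0. Qed.

Lemma su2_partZ a x : su2_part (rscale a x) = rscale a (su2_part x).
Proof. by rewrite /rscale; congr pair; rewrite /= scaler0. Qed.

Lemma su2_part_u1 z : lieU1 z -> su2_part z = 0.
Proof. by move=> [_ z2]; rewrite /su2_part z2. Qed.

Lemma su2_part_id x : lieSU2 x -> su2_part x = x.
Proof. by case: x => a b [_ /= ->]. Qed.

End U1Part.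

(** * The Levi-Civita connection on left-invariant fields *)

Section RealForms.
Variable R : realType.
Implicit Types (x y : mat R).

Definition real_form (phi : mat R -> R) : Prop :=
  forall a x y, phi (rscale a x + y) = a * phi x + phi y.

(** Turns real-linear identities in [mat R] into identities between real numbers, which [ring]
    proves once the values of the form are generalized. *)
Lemma mat_ext x y : (forall phi, real_form phi -> phi x = phi y) -> x = y.
Proof.
move=> e; apply/coords_inj/ambient_form_inj => m.
by apply: (e (fun x => m (coords x))) => a u v; rewrite coords_lin linearP.
Qed.

Variables (phi : mat R -> R) (phiL : real_form phi).

Lemma real_formD x y : phi (x + y) = phi x + phi y.
Proof. by rewrite -{1}[x]rscale1 phiL mul1r. Qed.

Lemma real_form0 : phi 0 = 0.
Proof. by apply/eqP; rewrite -(subrr (phi 0)) eq_sym subr_eq -real_formD addr0. Qed.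

Lemma real_formZ a x : phi (rscale a x) = a * phi x.
Proof. by rewrite -[rscale a x]addr0 phiL real_form0 addr0. Qed.

Lemma real_formN x : phi (- x) = - phi x.
Proof. by rewrite -rscaleN1 real_formZ mulN1r. Qed.

End RealForms.

Section LeviCivita.
Variables (R : realType) (g : U1SU2 R -> mat R -> mat R -> R).
Variable D : (U1SU2 R -> mat R) -> (U1SU2 R -> mat R) -> U1SU2 R -> mat R.
Hypotheses (gR : riemannian g) (gL : left_invariant g) (hD : levi_civita g D).
Implicit Types (u v w x y z : mat R) (p q : U1SU2 R) (f h : U1SU2 R -> R).
Implicit Types (X Y Z W : U1SU2 R -> mat R).
Let g1 := g (oneG R).

Lemma vector_fieldB X Y : vector_field X -> vector_field Y ->
  vector_field (fun p => X p - Y p).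
Proof.
move=> vX vY.
have -> : (fun p => X p - Y p) = fun p => rscale (-1) (Y p) + X p.
  by apply/funext => p; rewrite rscaleN1 addrC.
exact/vector_field_lin/vX/vY/smoothG_cst.
Qed.

Lemma connection_field X Y : vector_field X -> vector_field Y ->
  vector_field (D X Y).
Proof. by case: hD => -[+ _ _] _ _; apply. Qed.

Lemma connection_linl f X X' Y p : smoothG f ->
  vector_field X -> vector_field X' -> vector_field Y ->
  D (fun q => rscale (f q) (X q) + X' q) Y p =
  rscale (f p) (D X Y p) + D X' Y p.
Proof. by move=> *; case: hD => -[_ + _] _ _; apply. Qed.

Lemma connection_linr f X Y Y' p : smoothG f ->
  vector_field X -> vector_field Y -> vector_field Y' ->
  D X (fun q => rscale (f q) (Y q) + Y' q) p =
  rscale (applyvf X f p) (Y p) + rscale (f p) (D X Y p) + D X Y' p.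
Proof. by move=> *; case: hD => -[_ _ +] _ _; apply. Qed.

Lemma torsion_free X Y : vector_field X -> vector_field Y ->
  is_bracket X Y (fun p => D X Y p - D Y X p).
Proof. by case: hD => _ + _; apply. Qed.

Lemma metric_compat X Y Z p :
  vector_field X -> vector_field Y -> vector_field Z ->
  applyvf X (fun q => g q (Y q) (Z q)) p = g p (D X Y p) (Z p) + g p (Y p) (D X Z p).
Proof. by move=> *; case: hD => _ _; apply. Qed.

Lemma connection_field_sub X Y : vector_field X -> vector_field Y ->
  vector_field (fun p => D X Y p - D Y X p).
Proof. by move=> vX vY; apply: vector_fieldB; exact: connection_field. Qed.

(** Replacing the bracket by its torsion-free expression makes the curvature a function of three
    fields, so that tensoriality can be stated. *)
Definition curv X Y Z p : mat R :=
  curvature D X Y (fun q => D X Y q - D Y X q) Z p.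

Lemma curvature_curv X Y W Z p : vector_field X -> vector_field Y ->
  is_bracket X Y W -> curvature D X Y W Z p = curv X Y Z p.
Proof.
move=> vX vY bW; have -> : W = fun q => D X Y q - D Y X q.
  by apply/funext => q; exact: bracket_unique bW (torsion_free vX vY).
by [].
Qed.

(** Since [f X, Y] = f [X, Y] - (Y f) X, the bracket term contributes (Y f) D_X Z, which cancels the
    Leibniz term of D_Y (f D_X Z). *)
Lemma curv_tensorial1 f X X' Y Z p : smoothG f ->
  vector_field X -> vector_field X' -> vector_field Y -> vector_field Z ->
  curv (fun q => rscale (f q) (X q) + X' q) Y Z p =
  rscale (f p) (curv X Y Z p) + curv X' Y Z p.
Proof.
move=> sf vX vX' vY vZ; pose fX q := rscale (f q) (X q) + X' q.
have sYf : smoothG (fun q => -1 * applyvf Y f q).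
  by apply: smoothGM; [exact: smoothG_cst | case: vY => _; apply].
have vB A B : vector_field A -> vector_field B ->
  vector_field (fun q => D A B q - D B A q) by exact: connection_field_sub.
have e1 : D fX Z = fun q => rscale (f q) (D X Z q) + D X' Z q.
  by apply/funext => q; exact: connection_linl.
have e2 : (fun q => D fX Y q - D Y fX q) =
    fun q => rscale (f q) (D X Y q - D Y X q) +
      (rscale (-1 * applyvf Y f q) (X q) + (D X' Y q - D Y X' q)).
  apply/funext => q; rewrite /fX connection_linl// connection_linr//.
  apply: mat_ext => phi phiL; rewrite !(real_formD phiL, real_formN phiL, real_formZ phiL).
  move: (phi _) (phi _) (phi _) (phi _) (phi _) => a b c d e; ring.
rewrite /curv /curvature -/fX e1 e2.
rewrite (connection_linl p sf vX vX' (connection_field vY vZ)).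
rewrite (connection_linr p sf vY (connection_field vX vZ) (connection_field vX' vZ)).
rewrite (connection_linl p sf (vB _ _ vX vY)
  (vector_field_lin sYf vX (vB _ _ vX' vY)) vZ).
rewrite (connection_linl p sYf vX (vB _ _ vX' vY) vZ).
apply: mat_ext => phi phiL.
rewrite !(real_formD phiL, real_formN phiL, real_formZ phiL).
move: (phi _) (phi _) (phi _) (phi _) (phi _) (phi _) (phi _) => *; ring.
Qed.

(** Carries tensoriality over from the first argument to the second. *)
Lemma curvC X Y Z p : vector_field X -> vector_field Y -> vector_field Z ->
  curv Y X Z p = - curv X Y Z p.
Proof.
move=> vX vY vZ; have vB := connection_field_sub vX vY.
rewrite /curv /curvature.
have -> : (fun q => D Y X q - D X Y q) =
    fun q => rscale (-1) (D X Y q - D Y X q) + 0.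
  by apply/funext => q; rewrite addr0 rscaleN1 opprB.
rewrite (connection_linl p (smoothG_cst _) vB (vector_field0 R) vZ).
have -> : D (fun=> 0) Z p = 0.
  have := connection_linl p (smoothG_cst 1) (vector_field0 R) (vector_field0 R) vZ.
  have -> : (fun q : U1SU2 R => rscale 1 (0 : mat R) + 0) = fun=> 0.
    by apply/funext => q; rewrite rscaler0 addr0.
  move=> e; apply: mat_ext => phi phiL.
  move/(congr1 phi): e; rewrite (phiL 1) (real_form0 phiL).
  by move: (phi _) => a; lra.
apply: mat_ext => phi phiL.
rewrite !(real_formD phiL, real_formN phiL, real_formZ phiL, real_form0 phiL).
by move: (phi _) (phi _) (phi _) => *; ring.
Qed.

(** The mixed first-order terms are symmetric in X and Y and cancel; the second-order terms X (Y f)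
    - Y (X f) cancel against the derivative of [f] along the bracket, by torsion-freeness. *)
Lemma curv_tensorial3 f X Y Z Z' p : smoothG f ->
  vector_field X -> vector_field Y -> vector_field Z -> vector_field Z' ->
  curv X Y (fun q => rscale (f q) (Z q) + Z' q) p =
  rscale (f p) (curv X Y Z p) + curv X Y Z' p.
Proof.
move=> sf vX vY vZ vZ'; pose fZ q := rscale (f q) (Z q) + Z' q.
have vB := connection_field_sub vX vY.
have second A B : vector_field A -> vector_field B ->
    D A (D B fZ) p = rscale (applyvf A (applyvf B f) p) (Z p)
      + rscale (applyvf B f p) (D A Z p) + (rscale (applyvf A f p) (D B Z p)
      + rscale (f p) (D A (D B Z) p) + D A (D B Z') p).
  move=> vA vB'; have sBf : smoothG (applyvf B f) by case: vB' => _; apply.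
  have -> : D B fZ = fun q => rscale (applyvf B f q) (Z q) +
      (rscale (f q) (D B Z q) + D B Z' q).
    by apply/funext => q; rewrite /fZ connection_linr// addrA.
  have vDZ := connection_field vB' vZ; have vDZ' := connection_field vB' vZ'.
  by rewrite (connection_linr p sBf vA vZ (vector_field_lin sf vDZ vDZ'))
    (connection_linr p sf vA vDZ vDZ').
rewrite /curv /curvature -/fZ (second _ _ vX vY) (second _ _ vY vX).
rewrite /fZ (connection_linr p sf vB vZ vZ').
have [_ /(_ f sf p) ->] := torsion_free vX vY.
apply: mat_ext => phi phiL.
rewrite !(real_formD phiL, real_formN phiL, real_formZ phiL).
move: (applyvf X (applyvf Y f) p) (applyvf Y (applyvf X f) p) => *.
move: (applyvf X f p) (applyvf Y f p) (f p) => *.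
move: (phi _) (phi _) (phi _) (phi _) (phi _) => *.
move: (phi _) (phi _) (phi _) (phi _) => *; ring.
Qed.

Definition connL x y : mat R := D (linv x) (linv y) (oneG R).

Definition koszul x y z : R := (g1 (lie x y) z - g1 (lie y z) x + g1 (lie z x) y) / 2.

(** Inner products of left-invariant fields are constant, so compatibility makes the left side skew
    in its last two arguments. Torsion-freeness gives its antisymmetrization in the first two, and
    the resulting linear system has the Koszul expression as solution. *)
Lemma metric_connL x y z p : lieG x -> lieG y -> lieG z ->
  g p (D (linv x) (linv y) p) (linv z p) = koszul x y z.
Proof.
move=> xG yG zG; pose A a b c := g p (D (linv a) (linv b) p) (linv c p).
have tD a b : lieG a -> lieG b -> tangent p (D (linv a) (linv b) p).
  move=> aG bG.
  by have [] := connection_field (vector_field_linv aG) (vector_field_linv bG).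
have skew a b c : lieG a -> lieG b -> lieG c -> A a b c = - A a c b.
  move=> aG bG cG; have va := vector_field_linv aG.
  have vb := vector_field_linv bG; have vc := vector_field_linv cG.
  have := metric_compat p va vb vc.
  rewrite (_ : (fun q => g q _ _) = fun=> g1 b c); last first.
    by apply/funext => q; exact: left_invariant_linv.
  rewrite /applyvf dirder_cst; last exact: tangent_mul.
  rewrite (metricC gR _ (tD a c aG cG)); last exact: tangent_mul.
  by move/eqP; rewrite eq_sym addr_eq0 => /eqP.
have tors a b c : lieG a -> lieG b -> lieG c -> A a b c - A b a c = g1 (lie a b) c.
  move=> aG bG cG; rewrite /A -(metricBl gR (tD _ _ aG bG) (tD _ _ bG aG) (tangent_mul p cG)).
  have bD := torsion_free (vector_field_linv aG) (vector_field_linv bG).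
  rewrite (bracket_linv p aG bG bD) (left_invariant_linv _ gL)//.
  exact: lieG_lie.
rewrite -/(A x y z) /koszul -!tors//.
have := skew _ _ _ xG yG zG; have := skew _ _ _ yG zG xG.
have := skew _ _ _ zG xG yG.
move: (A _ _ _) (A _ _ _) (A _ _ _) (A _ _ _) (A _ _ _) (A _ _ _) => *; lra.
Qed.

Lemma lieG_connL x y : lieG x -> lieG y -> lieG (connL x y).
Proof.
move=> xG yG; apply/tangent1.
by have [] := connection_field (vector_field_linv xG) (vector_field_linv yG).
Qed.

Lemma connL_metric x y z : lieG x -> lieG y -> lieG z ->
  g1 (connL x y) z = koszul x y z.
Proof.
move=> xG yG zG; have := metric_connL (oneG R) xG yG zG.
by have -> : linv z (oneG R) = z by exact: mat_mul1.
Qed.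

(** Inner products with left-invariant fields do not depend on the point, and these fields exhaust
    every tangent space. *)
Lemma connection_linv x y : lieG x -> lieG y ->
  D (linv x) (linv y) = linv (connL x y).
Proof.
move=> xG yG; apply/funext => p; apply: (metric_nondeg gR (p := p)).
- by have [] := connection_field (vector_field_linv xG) (vector_field_linv yG).
- exact/tangent_mul/lieG_connL.
move=> z [w wG ->]; rewrite (metric_connL p xG yG wG) -connL_metric//.
exact/esym/(left_invariant_linv p gL (lieG_connL xG yG) wG).
Qed.

Lemma koszul_skew x y z : lieG x -> lieG y -> lieG z ->
  koszul x y z = - koszul x z y.
Proof.
move=> xG yG zG; rewrite /koszul (lieC x z) (lieC z y) (lieC y x).
have N v w z' : lieG v -> lieG w -> lieG z' -> g1 (- lie v w) z' = - g1 (lie v w) z'.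
  move=> vG wG /tangent1 zt; rewrite -rscaleN1 /g1 (metricZl gR) ?mulN1r//.
  exact/tangent1/lieG_lie.
rewrite !N//; move: (g1 _ _) (g1 _ _) (g1 _ _) => *; lra.
Qed.

(** Skewness of D_x moves the outer derivative onto the other argument: g(D_x D_y y, x) = - g(D_x x,
    D_y y), and likewise for the second term. Only [connL] at the identity remains. *)
Lemma curv_linv x y p : lieG x -> lieG y ->
  g p (curv (linv x) (linv y) (linv y) p) (linv x p) =
  - g1 (connL x x) (connL y y) + g1 (connL x y) (connL y x) - koszul (lie x y) y x.
Proof.
move=> xG yG; have cG := lieG_connL.
have W : (fun q => D (linv x) (linv y) q - D (linv y) (linv x) q) = linv (lie x y).
  have bD := torsion_free (vector_field_linv xG) (vector_field_linv yG).
  by apply/funext => q; exact: (bracket_linv q xG yG bD).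
rewrite /curv /curvature W (connection_linv yG yG) (connection_linv xG yG).
have tD a b : lieG a -> lieG b -> tangent p (D (linv a) (linv b) p).
  move=> aG bG.
  by have [] := connection_field (vector_field_linv aG) (vector_field_linv bG).
have t1 := tD _ _ xG (cG _ _ yG yG); have t2 := tD _ _ yG (cG _ _ xG yG).
have t3 := tD _ _ (lieG_lie xG yG) yG; have tx := tangent_mul p xG.
rewrite (metricBl gR (tangentB t1 t2) t3 tx) (metricBl gR t1 t2 tx).
rewrite (metric_connL p xG (cG _ _ yG yG) xG) (metric_connL p yG (cG _ _ xG yG) xG).
rewrite (metric_connL p (lieG_lie xG yG) yG xG).
rewrite (koszul_skew xG (cG _ _ yG yG) xG) (koszul_skew yG (cG _ _ xG yG) xG).
rewrite -(connL_metric xG xG (cG _ _ yG yG)) -(connL_metric yG xG (cG _ _ xG yG)).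
rewrite opprK; congr (_ + _ - _).
by apply: (metricC gR); exact/tangent1/cG.
Qed.

(** * Pointwise dependence of the curvature *)

Section Frame.
Variables f0 f1 f2 f3 : mat R.
Hypotheses (f0G : lieG f0) (f1G : lieG f1) (f2G : lieG f2) (f3G : lieG f3).

Definition comb4 a b c d :=
  rscale a f0 + (rscale b f1 + (rscale c f2 + rscale d f3)).

Hypothesis comb4_span : forall x, lieG x ->
  x = comb4 (g1 x f0) (g1 x f1) (g1 x f2) (g1 x f3).

Let coef X i p := g p (X p) (linv i p).

(** The trailing [0] gives every level of the sum the shape f A + B to which linearity over
    functions applies. *)
Lemma frame_expand X : vector_field X ->
  X = fun p => rscale (coef X f0 p) (linv f0 p) +
    (rscale (coef X f1 p) (linv f1 p) + (rscale (coef X f2 p) (linv f2 p) +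
    (rscale (coef X f3 p) (linv f3 p) + 0))).
Proof.
move=> [tX _]; apply/funext => p; rewrite addr0 /coef.
have [x xG ->] := tX p; rewrite !(left_invariant_linv p gL xG)//.
by rewrite {1}(comb4_span xG) /comb4 /linv !mat_mulDr !rscaleAr.
Qed.

(** The left-invariant frame is global, so expanding in it replaces the usual cutoff functions. The
    common value [Phi (fun=> 0)] appears on both sides. *)
Lemma tensorial_local p (Phi : (U1SU2 R -> mat R) -> mat R) X X' :
  (forall f A B, smoothG f -> vector_field A -> vector_field B ->
    Phi (fun q => rscale (f q) (A q) + B q) = rscale (f p) (Phi A) + Phi B) ->
  vector_field X -> vector_field X' -> X p = X' p -> Phi X = Phi X'.
Proof.
move=> Phi_lin.
suff expand Y : vector_field Y -> Phi Y =
    rscale (coef Y f0 p) (Phi (linv f0)) + (rscale (coef Y f1 p) (Phi (linv f1))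
    + (rscale (coef Y f2 p) (Phi (linv f2))
    + (rscale (coef Y f3 p) (Phi (linv f3)) + Phi (fun=> 0)))).
  by move=> vX vX' eX; rewrite (expand X vX) (expand X' vX') /coef eX.
move=> vY; rewrite {1}(frame_expand vY).
have s i : lieG i -> smoothG (coef Y i).
  by move=> iG; case: gR => _ _ _ sg; exact: (sg _ _ vY (vector_field_linv iG)).
have v0 := vector_field0 R.
have v3 := vector_field_lin (s _ f3G) (vector_field_linv f3G) v0.
have v2 := vector_field_lin (s _ f2G) (vector_field_linv f2G) v3.
have v1 := vector_field_lin (s _ f1G) (vector_field_linv f1G) v2.
rewrite (Phi_lin _ _ _ (s _ f0G) (vector_field_linv f0G) v1).
rewrite (Phi_lin _ _ _ (s _ f1G) (vector_field_linv f1G) v2).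
rewrite (Phi_lin _ _ _ (s _ f2G) (vector_field_linv f2G) v3).
by rewrite (Phi_lin _ _ _ (s _ f3G) (vector_field_linv f3G) v0).
Qed.

Lemma curv_local X X' Y Y' p :
  vector_field X -> vector_field X' -> vector_field Y -> vector_field Y' ->
  X p = X' p -> Y p = Y' p -> curv X Y Y p = curv X' Y' Y' p.
Proof.
move=> vX vX' vY vY' eX eY.
have local1 A A' B C : vector_field A -> vector_field A' -> vector_field B ->
    vector_field C -> A p = A' p -> curv A B C p = curv A' B C p.
  move=> vA vA' vB vC; apply: (tensorial_local (Phi := fun A => curv A B C p)) => //.
  by move=> *; exact: curv_tensorial1.
rewrite (local1 X X')// -[LHS]opprK -curvC// (local1 Y Y')// curvC// opprK.
apply: (tensorial_local (p := p) (Phi := fun C => curv X' Y' C p)) => //.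
by move=> *; exact: curv_tensorial3.
Qed.

End Frame.

End LeviCivita.

(** * The curvature form in an orthonormal basis *)

Section KoszulAlgebra.
Variable R : realType.
Notation vec := (R * R * R * R)%type.
Implicit Types (x y z : vec).

Definition dot4 x y : R :=
  let: (x0, x1, x2, x3) := x in let: (y0, y1, y2, y3) := y in
  x0 * y0 + x1 * y1 + x2 * y2 + x3 * y3.

Definition basis4 : seq vec :=
  [:: (1, 0, 0, 0); (0, 1, 0, 0); (0, 0, 1, 0); (0, 0, 0, 1)].

Variables L1 L2 L3 b1 b2 b3 : R.

(* Bracket of an orthonormal basis (E_0, e_1, e_2, e_3) for which
   [e_i, e_j] = L_k e_k cyclically and ad E_0 = ad (b_1 e_1 + b_2 e_2 + b_3 e_3). *)
Definition br4 x y : vec :=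
  let: (x0, x1, x2, x3) := x in let: (y0, y1, y2, y3) := y in
  let X1 := x1 + x0 * b1 in let X2 := x2 + x0 * b2 in let X3 := x3 + x0 * b3 in
  let Y1 := y1 + y0 * b1 in let Y2 := y2 + y0 * b2 in let Y3 := y3 + y0 * b3 in
  (0, L1 * (X2 * Y3 - X3 * Y2), L2 * (X3 * Y1 - X1 * Y3),
   L3 * (X1 * Y2 - X2 * Y1)).

Definition koszul4 x y z : R :=
  (dot4 (br4 x y) z - dot4 (br4 y z) x + dot4 (br4 z x) y) / 2.

Definition curv4 x y : R :=
  - (\sum_(f <- basis4) koszul4 x x f * koszul4 y y f)
  + \sum_(f <- basis4) koszul4 x y f * koszul4 y x f - koszul4 (br4 x y) y x.

(** Milnor's formulas for the sectional curvatures of a left-invariant metric on SU(2), L3 m3 - m1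
    m2 with m_i = (L1 + L2 + L3) / 2 - L_i, and its cyclic images. *)
Definition sec12 : R :=
  (2 * L1 * L3 + 2 * L2 * L3 - 3 * L3 ^+ 2 + (L1 - L2) ^+ 2) / 4.
Definition sec23 : R :=
  (2 * L2 * L1 + 2 * L3 * L1 - 3 * L1 ^+ 2 + (L2 - L3) ^+ 2) / 4.
Definition sec31 : R :=
  (2 * L3 * L2 + 2 * L1 * L2 - 3 * L2 ^+ 2 + (L3 - L1) ^+ 2) / 4.

(* The Ricci curvature of E_0 is minus the squared norm of the symmetric part
   of ad E_0. *)
Lemma curv4_ricci :
  curv4 (0, 1, 0, 0) (1, 0, 0, 0) + curv4 (0, 0, 1, 0) (1, 0, 0, 0)
  + curv4 (0, 0, 0, 1) (1, 0, 0, 0) =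
  - ((b1 * (L2 - L3)) ^+ 2 + (b2 * (L3 - L1)) ^+ 2 + (b3 * (L1 - L2)) ^+ 2) / 2.
Proof.
rewrite /curv4 /koszul4 /br4 /dot4 !big_cons !big_nil; by field.
Qed.

(** The equations say that ad E_0 is skew; as E_0 is also orthogonal to all brackets, it is then
    parallel, and the coordinates [x0] and [y0] disappear. *)
Lemma curv4_flat x y :
  b1 * (L2 - L3) = 0 -> b2 * (L3 - L1) = 0 -> b3 * (L1 - L2) = 0 ->
  curv4 x y =
  let: (x0, x1, x2, x3) := x in let: (y0, y1, y2, y3) := y in
  sec12 * (x1 * y2 - x2 * y1) ^+ 2 + sec23 * (x2 * y3 - x3 * y2) ^+ 2
  + sec31 * (x3 * y1 - x1 * y3) ^+ 2.
Proof.
case: x => [[[x0 x1] x2] x3]; case: y => [[[y0 y1] y2] y3].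
rewrite /sec12 /sec23 /sec31 => /eqP + /eqP + /eqP.
rewrite /curv4 /koszul4 /br4 /dot4 !big_cons !big_nil !mulf_eq0 !subr_eq0.
(* If [h1] and [h3] are both equalities between structure constants, rewriting by [h3] brings [L2]
   back, hence the second [h1]. *)
by move=> /orP[] /eqP h1 /orP[] /eqP h2 /orP[] /eqP h3;
  rewrite ?h1 ?h2 ?h3 ?h1; field.
Qed.

End KoszulAlgebra.

(** * Sectional curvature in a left-invariant orthonormal frame *)

Section Reduction.
Variables (R : realType) (g : U1SU2 R -> mat R -> mat R -> R).
Variable D : (U1SU2 R -> mat R) -> (U1SU2 R -> mat R) -> U1SU2 R -> mat R.
Hypotheses (gR : riemannian g) (gL : left_invariant g) (hD : levi_civita g D).
Let g1 := g (oneG R).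
Variables f0 f1 f2 f3 : mat R.
Hypotheses (f0G : lieG f0) (f1G : lieG f1) (f2G : lieG f2) (f3G : lieG f3).
Hypotheses (o00 : g1 f0 f0 = 1) (o11 : g1 f1 f1 = 1) (o22 : g1 f2 f2 = 1)
  (o33 : g1 f3 f3 = 1) (o01 : g1 f0 f1 = 0) (o02 : g1 f0 f2 = 0)
  (o03 : g1 f0 f3 = 0) (o12 : g1 f1 f2 = 0) (o13 : g1 f1 f3 = 0)
  (o23 : g1 f2 f3 = 0).
Hypothesis span : forall x, lieG x ->
  x = comb4 f0 f1 f2 f3 (g1 x f0) (g1 x f1) (g1 x f2) (g1 x f3).
Variables L1 L2 L3 b1 b2 b3 : R.
Notation vec := (R * R * R * R)%type.

Definition of_vec (x : vec) : mat R :=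
  let: (a, b, c, d) := x in comb4 f0 f1 f2 f3 a b c d.

Hypothesis lie_of_vec : forall x y,
  lie (of_vec x) (of_vec y) = of_vec (br4 L1 L2 L3 b1 b2 b3 x y).

Lemma lieG_of_vec x : lieG (of_vec x).
Proof.
case: x => [[[a b] c] d].
by apply/lieG_lin/lieG_lin/lieG_lin/lieGZ.
Qed.

Lemma metric_of_vecl x v : lieG v ->
  g1 (of_vec x) v = dot4 x (g1 f0 v, g1 f1 v, g1 f2 v, g1 f3 v).
Proof.
move=> vG; case: x => [[[a b] c] d]; have t w : lieG w -> tangent (oneG R) w.
  by move=> wG; exact/tangent1.
have vt := t v vG; rewrite /g1 /of_vec /comb4 /dot4.
rewrite (metric_linl gR _ (t _ f0G) _ vt); last exact/t/lieG_lin/lieG_lin/lieGZ.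
rewrite (metric_linl gR _ (t _ f1G) _ vt); last exact/t/lieG_lin/lieGZ.
rewrite (metric_linl gR _ (t _ f2G) _ vt); last exact/t/lieGZ.
by rewrite (metricZl gR _ (t _ f3G) vt) !addrA.
Qed.

Lemma metric_sym v w : lieG v -> lieG w -> g1 v w = g1 w v.
Proof. by move=> /tangent1 vt /tangent1 wt; exact: metricC. Qed.

Lemma of_vec_coord x : (g1 f0 (of_vec x), g1 f1 (of_vec x), g1 f2 (of_vec x),
  g1 f3 (of_vec x)) = x.
Proof.
have xG := lieG_of_vec x.
rewrite !(fun v vG => metric_sym (v := v) vG xG)// !metric_of_vecl//.
rewrite (metric_sym f1G f0G) (metric_sym f2G f0G) (metric_sym f3G f0G).
rewrite (metric_sym f2G f1G) (metric_sym f3G f1G) (metric_sym f3G f2G).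
rewrite o00 o11 o22 o33 o01 o02 o03 o12 o13 o23.
case: x xG => [[[a b] c] d] _; rewrite /dot4.
by rewrite !(mulr0, mulr1, addr0, add0r).
Qed.

Lemma metric_of_vec x y : g1 (of_vec x) (of_vec y) = dot4 x y.
Proof. by rewrite metric_of_vecl ?of_vec_coord//; exact: lieG_of_vec. Qed.

Lemma of_vecP v : lieG v -> exists x, v = of_vec x.
Proof.
by move=> vG; exists (g1 v f0, g1 v f1, g1 v f2, g1 v f3); rewrite {1}(span vG).
Qed.

Lemma koszul_of_vec x y z : koszul g (of_vec x) (of_vec y) (of_vec z) =
  koszul4 L1 L2 L3 b1 b2 b3 x y z.
Proof. by rewrite /koszul /koszul4 !lie_of_vec -/g1 !metric_of_vec. Qed.

Lemma connL_parseval x y z w :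
  g1 (connL D (of_vec x) (of_vec y)) (connL D (of_vec z) (of_vec w)) =
  \sum_(f <- basis4 R) koszul4 L1 L2 L3 b1 b2 b3 x y f *
    koszul4 L1 L2 L3 b1 b2 b3 z w f.
Proof.
have G := lieG_of_vec.
have [n en] := of_vecP (lieG_connL hD (G x) (G y)).
have [m em] := of_vecP (lieG_connL hD (G z) (G w)).
have kn f : koszul4 L1 L2 L3 b1 b2 b3 x y f = dot4 n f.
  by rewrite -koszul_of_vec -(connL_metric gR gL hD)// en -/g1 metric_of_vec.
have km f : koszul4 L1 L2 L3 b1 b2 b3 z w f = dot4 m f.
  by rewrite -koszul_of_vec -(connL_metric gR gL hD)// em -/g1 metric_of_vec.
rewrite en em metric_of_vec !big_cons big_nil !kn !km.
move: n m {en em kn km} => [[[n0 n1] n2] n3] [[[m0 m1] m2] m3].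
rewrite /dot4; ring.
Qed.

Lemma curv_of_vec x y p :
  g p (curv D (linv (of_vec x)) (linv (of_vec y)) (linv (of_vec y)) p)
    (linv (of_vec x) p) = curv4 L1 L2 L3 b1 b2 b3 x y.
Proof.
have G := lieG_of_vec; rewrite (curv_linv gR gL hD)// -/g1 !connL_parseval.
by rewrite lie_of_vec koszul_of_vec.
Qed.

Lemma orthonormal_lin_indep p v w : tangent p v -> tangent p w ->
  g p v v = 1 -> g p w w = 1 -> g p v w = 0 -> lin_indep v w.
Proof.
move=> tv tw vv ww vw a b e.
have av := metric_linl gR a tv (tangentZ b tw) tv.
have bw := metric_linl gR a tv (tangentZ b tw) tw.
rewrite e (metric0l gR)// vv (metricZl gR)// (metricC gR)// vw in av.
rewrite e (metric0l gR)// vw (metricZl gR)// ww in bw.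
by split; [move: av | move: bw]; rewrite ?(mulr0, mulr1, addr0, add0r).
Qed.

Lemma nonneg_curv4 x y : dot4 x x = 1 -> dot4 y y = 1 -> dot4 x y = 0 ->
  nonneg_sectional g D -> 0 <= curv4 L1 L2 L3 b1 b2 b3 x y.
Proof.
move=> xx yy xy nn; have G := lieG_of_vec; pose p := oneG R.
have vx := vector_field_linv (G x); have vy := vector_field_linv (G y).
have metricE a c : g p (linv (of_vec a) p) (linv (of_vec c) p) = dot4 a c.
  by rewrite (left_invariant_linv p gL (G a) (G c)) -/g1 metric_of_vec.
have li : lin_indep (linv (of_vec x) p) (linv (of_vec y) p).
  by apply: (@orthonormal_lin_indep p); rewrite ?metricE//; exact: tangent_mul.
have bD := torsion_free hD vx vy.
have := nn _ _ _ vx vy bD p li.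
rewrite /sectional (curvature_curv hD _ _ vx vy bD) curv_of_vec !metricE xx yy xy.
by rewrite mulr1 expr0n subr0 divr1.
Qed.

Lemma nonneg_sectionalP : nonneg_sectional g D <->
  [/\ b1 * (L2 - L3) = 0, b2 * (L3 - L1) = 0 & b3 * (L1 - L2) = 0] /\
  [/\ 0 <= sec12 L1 L2 L3, 0 <= sec23 L1 L2 L3 & 0 <= sec31 L1 L2 L3].
Proof.
split=> [nn|[[h1 h2 h3] [s12 s23 s31]] X Y W vX vY bW p li].
  have pos x y : dot4 x x = 1 -> dot4 y y = 1 -> dot4 x y = 0 ->
      0 <= curv4 L1 L2 L3 b1 b2 b3 x y by move=> *; exact: nonneg_curv4.
  have [h1 h2 h3] :
      [/\ b1 * (L2 - L3) = 0, b2 * (L3 - L1) = 0 & b3 * (L1 - L2) = 0].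
    have := curv4_ricci L1 L2 L3 b1 b2 b3.
    have := pos (0, 1, 0, 0) (1, 0, 0, 0); have := pos (0, 0, 1, 0) (1, 0, 0, 0).
    have := pos (0, 0, 0, 1) (1, 0, 0, 0).
    rewrite /dot4 !(mulr0, mulr1, addr0, add0r) => /(_ erefl erefl erefl) p3.
    move=> /(_ erefl erefl erefl) p2 /(_ erefl erefl erefl) p1 ric.
    have q1 := sqr_ge0 (b1 * (L2 - L3)); have q2 := sqr_ge0 (b2 * (L3 - L1)).
    have q3 := sqr_ge0 (b3 * (L1 - L2)).
    move: p1 p2 p3 ric q1 q2 q3.
    move: (curv4 _ _ _ _ _ _ _ _) (curv4 _ _ _ _ _ _ _ _)
      (curv4 _ _ _ _ _ _ _ _) => c1 c2 c3 p1 p2 p3 ric q1 q2 q3.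
    (* Three nonnegative numbers add up to minus half a sum of squares, so every square is 0. *)
    by split; apply/eqP; rewrite -sqrf_eq0; apply/eqP; lra.
  split=> //; split.
  - rewrite (_ : sec12 _ _ _ = curv4 L1 L2 L3 b1 b2 b3 (0, 1, 0, 0) (0, 0, 1, 0)).
      by apply: pos; rewrite /dot4; ring.
    by rewrite curv4_flat//; ring.
  - rewrite (_ : sec23 _ _ _ = curv4 L1 L2 L3 b1 b2 b3 (0, 0, 1, 0) (0, 0, 0, 1)).
      by apply: pos; rewrite /dot4; ring.
    by rewrite curv4_flat//; ring.
  - rewrite (_ : sec31 _ _ _ = curv4 L1 L2 L3 b1 b2 b3 (0, 0, 0, 1) (0, 1, 0, 0)).
      by apply: pos; rewrite /dot4; ring.
    by rewrite curv4_flat//; ring.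
have [x [xG eX]] : exists x, lieG x /\ X p = linv x p.
  by case: vX => /(_ p) [x xG ->] _; exists x.
have [y [yG eY]] : exists y, lieG y /\ Y p = linv y p.
  by case: vY => /(_ p) [y yG ->] _; exists y.
rewrite /sectional (curvature_curv hD _ _ vX vY bW).
rewrite (curv_local gR gL hD f0G f1G f2G f3G span vX (vector_field_linv xG)
  vY (vector_field_linv yG) eX eY) eX eY.
have [a ea] := of_vecP xG; have [c ec] := of_vecP yG.
rewrite !(left_invariant_linv p gL)// ea ec curv_of_vec -/g1 !metric_of_vec.
rewrite curv4_flat//; move: a c {ea ec} => [[[a0 a1] a2] a3] [[[c0 c1] c2] c3].
apply: divr_ge0; first by rewrite !addr_ge0// mulr_ge0// sqr_ge0.
(* Lagrange's identity: the Gram determinant is the sum of the squared 2 x 2 minors. *)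
rewrite /dot4 [leRHS](_ : _ = (a0 * c1 - a1 * c0) ^+ 2 + (a0 * c2 - a2 * c0) ^+ 2
  + (a0 * c3 - a3 * c0) ^+ 2 + (a1 * c2 - a2 * c1) ^+ 2 + (a1 * c3 - a3 * c1) ^+ 2
  + (a2 * c3 - a3 * c2) ^+ 2); last by ring.
by rewrite !addr_ge0// sqr_ge0.
Qed.

End Reduction.

(** * The two conditions *)

Section Assembly.
Variable R : realType.
Implicit Types (u v w x y z : mat R).

Lemma ord3P (i : 'I_3) : [\/ i = 0, i = 1 | i = 2].
Proof.
by case: i => -[|[|[|//]]] i3; [apply: Or31|apply: Or32|apply: Or33];
  exact: val_inj.
Qed.

Lemma ord3_perm (s : 'S_3) (i : 'I_3) : [\/ i = s 0, i = s 1 | i = s 2].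
Proof.
rewrite -(permKV s i); case: (ord3P ((s^-1)%g i)) => ->.
- exact: Or31.
- exact: Or32.
- exact: Or33.
Qed.

Lemma eqf_sqr_gt0 (a b : R) : 0 < a -> 0 < b -> (a ^+ 2 - b ^+ 2 == 0) = (a == b).
Proof.
move=> a0 b0; rewrite subr_eq0; apply/idP/idP => [/eqP|/eqP ->//].
by move/(congr1 Num.sqrt); rewrite !sqrtr_sqr !gtr0_norm// => ->.
Qed.

(** Each product vanishes through one of its factors. If always through [b], the first alternative
    holds; if through one equality of the [l i], the third, [s 2] being the index whose [b] stays
    free; two equalities make all the [l i] coincide. *)
Lemma skew_conditionP (l b : 'I_3 -> R) : (forall i, 0 < l i) ->
  [/\ b 0 * (l 1 ^+ 2 - l 2 ^+ 2) = 0, b 1 * (l 2 ^+ 2 - l 0 ^+ 2) = 0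
    & b 2 * (l 0 ^+ 2 - l 1 ^+ 2) = 0] <->
  [\/ forall i, b i = 0, l 0 = l 1 /\ l 1 = l 2
    | exists s : 'S_3, l (s 0) = l (s 1) /\ b (s 0) = 0 /\ b (s 1) = 0].
Proof.
move=> l0; split.
  move=> [/eqP + /eqP + /eqP]; rewrite !mulf_eq0 !eqf_sqr_gt0//.
  move=> /orP[/eqP h0|/eqP h0] /orP[/eqP h1|/eqP h1] /orP[/eqP h2|/eqP h2].
  - by apply: Or31 => i; case: (ord3P i) => ->.
  - by apply: Or33; exists 1%g; rewrite !perm1.
  - apply: Or33; exists (tperm 1 2).
    by rewrite (tpermD (z := 0))// tpermL.
  - by apply: Or32; rewrite h1 h2; split=> //; rewrite -h2 h1.
  - apply: Or33; exists (tperm 0 2).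
    by rewrite tpermL (tpermD (z := 1)).
  - by apply: Or32; rewrite h0 h2 h0.
  - by apply: Or32; rewrite h0 h1.
  - by apply: Or32; rewrite h0 h1.
have crit (i j k : 'I_3) : b i = 0 \/ l j = l k -> b i * (l j ^+ 2 - l k ^+ 2) = 0.
  by move=> [->|->]; rewrite ?mul0r ?subrr ?mulr0.
case=> [bz|[e1 e2]|[s [es [s0 s1]]]].
- by split; apply: crit; left.
- by split; apply: crit; right; rewrite ?e1 ?e2.
(* Only [b (s 2)] can be nonzero, and its factor compares the two other indices, where [l]
   agrees. *)
have sz i : b i = 0 \/ i = s 2.
  by case: (ord3_perm s i) => ->; [left|left|right].
have sl i j k : i = s 2 -> i != j -> i != k -> l j = l k.
  move=> ->; case: (ord3_perm s j) => ->; case: (ord3_perm s k) => ->;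
  by rewrite ?eqxx // ?es.
have all i j k : i != j -> i != k -> b i * (l j ^+ 2 - l k ^+ 2) = 0.
  move=> ij ik; apply: crit; case: (sz i) => [bi|h]; first by left.
  by right; exact: sl h ij ik.
by split; apply: all.
Qed.

Lemma real_form_comb3 (phi : mat R -> R) v0 v1 v2 (a b c : R) : real_form phi ->
  phi (comb3 v0 v1 v2 a b c) = a * phi v0 + b * phi v1 + c * phi v2.
Proof. by move=> phiL; rewrite /comb3 2!phiL (real_formZ phiL) addrA. Qed.

Lemma real_form_comb4 (phi : mat R -> R) v0 v1 v2 v3 (a b c d : R) :
  real_form phi -> phi (comb4 v0 v1 v2 v3 a b c d) =
  a * phi v0 + b * phi v1 + c * phi v2 + d * phi v3.
Proof. by move=> phiL; rewrite /comb4 3!phiL (real_formZ phiL) !addrA. Qed.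

Lemma lie_comb3l v0 v1 v2 (a b c : R) x :
  lie (comb3 v0 v1 v2 a b c) x = comb3 (lie v0 x) (lie v1 x) (lie v2 x) a b c.
Proof. by rewrite /comb3 2!lie_linl lieZl. Qed.

Lemma lie_comb3r v0 v1 v2 (a b c : R) x :
  lie x (comb3 v0 v1 v2 a b c) = comb3 (lie x v0) (lie x v1) (lie x v2) a b c.
Proof. by rewrite /comb3 2!lie_linr lieZr. Qed.

Lemma lie_comb3 v0 v1 v2 (L0 L1 L2 a b c a' b' c' : R) :
  lie v0 v1 = rscale L2 v2 -> lie v1 v2 = rscale L0 v0 ->
  lie v2 v0 = rscale L1 v1 ->
  lie (comb3 v0 v1 v2 a b c) (comb3 v0 v1 v2 a' b' c') =
  comb3 v0 v1 v2 (L0 * (b * c' - c * b')) (L1 * (c * a' - a * c'))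
    (L2 * (a * b' - b * a')).
Proof.
have self x : lie x x = rscale 0 x by rewrite lie_xx rscale0.
have anti x y : lie y x = rscale (-1) (lie x y) by rewrite rscaleN1; exact: lieC.
move=> h01 h12 h20; rewrite lie_comb3l 3!lie_comb3r 3!self.
rewrite (anti v0 v1) (anti v1 v2) (anti v2 v0) h01 h12 h20 !rscaleA.
apply: mat_ext => phi phiL; have fc := fun v0 v1 v2 a b c => @real_form_comb3 phi v0 v1 v2 a b c phiL.
have fZ := @real_formZ _ phi phiL.
apply: etrans (fc _ _ _ _ _ _) _; apply: esym; apply: etrans (fc _ _ _ _ _ _) _.
rewrite 3!fc 9!fZ.
move: (phi _) (phi _) (phi _) => *; ring.
Qed.

End Assembly.

(** * The orthonormal basis of the Lie algebra *)

Section Curvature.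
Variables (R : realType) (g : U1SU2 R -> mat R -> mat R -> R).
Hypotheses (gR : riemannian g).
Let g1 := g (oneG R).
Variables (e : 'I_3 -> mat R) (E0 : mat R).
Hypotheses (eS : forall i, lieSU2 (e i))
  (e_orth : forall i j, g1 (e i) (e j) = (i == j)%:R)
  (E0G : lieG E0) (E0_unit : g1 E0 E0 = 1)
  (E0_orth : forall x, lieSU2 x -> g1 E0 x = 0).

(** As u(1) is central, [E0] and its component [w0] have the same ad. The component is taken along
    u(1), so it can be nonzero although the orthogonal projection of [E0] to su(2) is 0. *)
Let w0 := su2_part E0.
Let b i := g1 w0 (e i).

Let w0S : lieSU2 w0. Proof. exact: lieSU2_part. Qed.

Lemma su2_part_span x : lieSU2 x ->
  x = comb3 (e 0) (e 1) (e 2) (g1 x (e 0)) (g1 x (e 1)) (g1 x (e 2)).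
Proof. by move=> xS; apply: (comb3_span gR) => //; rewrite e_orth. Qed.

Lemma u1_part_neq0 : u1_part E0 != 0.
Proof.
apply/eqP => z; have E0S : lieSU2 E0 by split=> //; case: z.
by have := E0_orth E0S; rewrite E0_unit => /eqP; rewrite oner_eq0.
Qed.

Lemma exists_comb4 x : lieG x -> exists a c d k,
  x = comb4 E0 (e 0) (e 1) (e 2) a c d k.
Proof.
move=> xG.
have [a ea] := lieU1_line (lieU1_part E0G) u1_part_neq0 (lieU1_part xG).
(* This vector is [x] minus [a] times [E0], where [a] matches the u(1) components. *)
have yS : lieSU2 (rscale (- a) w0 + su2_part x) by exact/lieSU2_lin/lieSU2_part.
have := su2_part_span yS; move: (g1 _ (e 0)) (g1 _ (e 1)) (g1 _ (e 2)) => c d k ey.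
exists a, c, d, k; rewrite /comb4 -/(comb3 _ _ _ _ _ _) -ey.
rewrite {1}(partE x) {1}(partE E0) ea -/w0.
apply: mat_ext => phi phiL.
rewrite !(real_formD phiL) !(real_formZ phiL) !(real_formD phiL).
move: (phi _) (phi _) (phi _) => *; ring.
Qed.

(** Splitting [E0] into its central part and [w0] produces the shifted coordinates x_i + x_0 b_i
    that occur in [br4]. *)
Lemma comb4_shift a c d k : comb4 E0 (e 0) (e 1) (e 2) a c d k =
  rscale a (u1_part E0) + comb3 (e 0) (e 1) (e 2) (c + a * b 0) (d + a * b 1)
    (k + a * b 2).
Proof.
apply: mat_ext => phi phiL.
have eE0 : phi E0 = phi (u1_part E0) + phi w0.
  by rewrite {1}(partE E0); exact: real_formD.
have ew0 : phi w0 = b 0 * phi (e 0) + b 1 * phi (e 1) + b 2 * phi (e 2).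
  by rewrite {1}(su2_part_span w0S); exact: real_form_comb3.
apply: etrans (real_form_comb4 _ _ _ _ _ _ _ _ phiL) _; rewrite eE0 ew0.
apply: esym; apply: etrans (phiL _ _ _) _.
apply: etrans (congr1 _ (real_form_comb3 _ _ _ _ _ _ phiL)) _.
move: (phi _) (phi _) (phi _) (phi _) => *; ring.
Qed.

Lemma lie_comb4 (L0 L1 L2 : R) x y :
  lie (e 0) (e 1) = rscale L2 (e 2) -> lie (e 1) (e 2) = rscale L0 (e 0) ->
  lie (e 2) (e 0) = rscale L1 (e 1) ->
  lie (of_vec E0 (e 0) (e 1) (e 2) x) (of_vec E0 (e 0) (e 1) (e 2) y) =
  of_vec E0 (e 0) (e 1) (e 2) (br4 L0 L1 L2 (b 0) (b 1) (b 2) x y).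
Proof.
move=> h01 h12 h20.
case: x => [[[x0 x1] x2] x3]; case: y => [[[y0 y1] y2] y3].
rewrite /of_vec /br4 !comb4_shift lie_linl (lieU1_central _ (z := u1_part E0))//.
rewrite lie_linr (lieC (u1_part E0)) (lieU1_central _ (z := u1_part E0))//.
rewrite (lie_comb3 _ _ _ _ _ _ h01 h12 h20) !mul0r !addr0 rscale0 rscaler0 oppr0 rscaler0.
by rewrite !add0r.
Qed.

Lemma comb4_metric_span x : lieG x -> x = comb4 E0 (e 0) (e 1) (e 2)
  (g1 x E0) (g1 x (e 0)) (g1 x (e 1)) (g1 x (e 2)).
Proof.
move=> xG; have [a [c [d [k ex]]]] := exists_comb4 xG.
have eG i : lieG (e i) by case: (eS i).
have ee i : g1 (e i) (e i) = 1 by rewrite e_orth eqxx.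
have ne i j : i != j -> g1 (e i) (e j) = 0 by move=> /negPf ij; rewrite e_orth ij.
have := of_vec_coord gR E0G (eG 0) (eG 1) (eG 2) E0_unit (ee 0) (ee 1) (ee 2)
  (E0_orth (eS 0)) (E0_orth (eS 1)) (E0_orth (eS 2)) (ne 0 1 isT) (ne 0 2 isT)
  (ne 1 2 isT) (a, c, d, k).
rewrite /of_vec -ex => -[e0 e1 e2 e3].
have sym v : lieG v -> g1 x v = g1 v x by move=> vG; exact: (metric_sym gR).
rewrite (sym _ E0G) (sym _ (eG 0)) (sym _ (eG 1)) (sym _ (eG 2)).
by rewrite /g1 e0 e1 e2 e3; exact: ex.
Qed.

(** Both sides say that [w0] is 0. *)
Lemma parallel_u1P e0 : lieU1 e0 -> e0 != 0 ->
  (exists c, E0 = rscale c e0) <-> forall i, b i = 0.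
Proof.
move=> e0U e0_neq0; split=> [[c eE] i|bz].
  have -> : b i = g1 0 (e i).
    by congr g1; rewrite /w0 eE su2_partZ su2_part_u1// rscaler0.
  exact/(metric0l gR)/tangent1/(proj1 (eS i)).
have [c ec] := lieU1_line e0U e0_neq0 (lieU1_part E0G).
exists c; rewrite -ec {1}(partE E0) -/w0 (su2_part_span w0S) -!/(b _) !bz.
by rewrite /comb3 !rscale0 !addr0.
Qed.

(** Both sides say that [w0] is a multiple of [e (s 2)]. *)
Lemma span_u1_eP e0 (s : 'S_3) : lieU1 e0 -> e0 != 0 ->
  (exists a c, E0 = rscale a e0 + rscale c (e (s 2))) <->
  b (s 0) = 0 /\ b (s 1) = 0.
Proof.
move=> e0U e0_neq0; split=> [[a [c eE]]|[s0 s1]].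
  have ew : w0 = rscale c (e (s 2)).
    rewrite /w0 eE su2_partD !su2_partZ su2_part_u1// rscaler0 add0r.
    by rewrite (su2_part_id (eS _)).
  have bE i : b i = c * (s 2 == i)%:R.
    have t j : tangent (oneG R) (e j) by apply/tangent1; case: (eS j).
    by rewrite /b ew /g1 (metricZl gR)// -/g1 e_orth.
  by rewrite !bE !(inj_eq perm_inj) /= !mulr0.
have bz i : i != s 2 -> b i = 0 by case: (ord3_perm s i) => ->; rewrite ?eqxx.
have [a ea] := lieU1_line e0U e0_neq0 (lieU1_part E0G).
exists a, (b (s 2)); rewrite -ea {1}(partE E0) -/w0; congr (_ + _).
rewrite (su2_part_span w0S) -!/(b _) /comb3.
case: (ord3P (s 2)) bz => -> bz.
- by rewrite (bz 1)// (bz 2)// !rscale0 !addr0.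
- by rewrite (bz 0)// (bz 2)// !rscale0 addr0 add0r.
- by rewrite (bz 0)// (bz 1)// !rscale0 !add0r.
Qed.

End Curvature.

Lemma sec_ratio (R : realType) (k l0 l1 l2 : R) : k != 0 -> l2 != 0 ->
  let x := l0 / l2 in let y := l1 / l2 in
  let L0 := k * l0 ^+ 2 in let L1 := k * l1 ^+ 2 in let L2 := k * l2 ^+ 2 in
  [/\ (0 <= sec12 L0 L1 L2) = (0 <= 2 * x ^+ 2 + 2 * y ^+ 2 - 3 + x ^+ 4
            - 2 * x ^+ 2 * y ^+ 2 + y ^+ 4),
      (0 <= sec23 L0 L1 L2) = (0 <= 2 * x ^+ 2 - 3 * x ^+ 4 + 2 * x ^+ 2 * y ^+ 2
            - 2 * y ^+ 2 + 1 + y ^+ 4)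
    & (0 <= sec31 L0 L1 L2) = (0 <= 2 * y ^+ 2 - 3 * y ^+ 4 + 2 * x ^+ 2 * y ^+ 2
            - 2 * x ^+ 2 + 1 + x ^+ 4)].
Proof.
move=> k0 l20 x y L0 L1 L2.
(* The three expressions are homogeneous of degree 2 in the L's; dividing by the square of [L2]
   leaves the ratios, and the 4 is their common denominator. *)
have c0 : 0 < (k * l2 ^+ 2) ^+ 2 / 4.
  by rewrite divr_gt0// exprn_even_gt0//= mulf_neq0// expf_neq0.
split.
- rewrite -[RHS](pmulr_rge0 _ c0); congr (0 <= _).
  by rewrite /sec12 /L0 /L1 /L2 /x /y; field.
- rewrite -[RHS](pmulr_rge0 _ c0); congr (0 <= _).
  by rewrite /sec23 /L0 /L1 /L2 /x /y; field.
- rewrite -[RHS](pmulr_rge0 _ c0); congr (0 <= _).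
  by rewrite /sec31 /L0 /L1 /L2 /x /y; field.
Qed.

(** Both summands are the metric at the identity, pulled back by the inverse [P ^t*] and restricted
    to one factor. The cross terms vanish because [z] spans u(1). *)
Lemma product_metric_u1 (R : realType) (g : U1SU2 R -> mat R -> mat R -> R)
    (z : mat R) : riemannian g -> left_invariant g -> lieU1 z -> z != 0 ->
  (forall x, lieSU2 x -> g (oneG R) z x = 0) -> product_metric g.
Proof.
move=> gR gL zU z0 orth.
exists (fun P v w => g (oneG R) (P ^t* *m v, 0) (P ^t* *m w, 0)),
  (fun P v w => g (oneG R) (0, P ^t* *m v) (0, P ^t* *m w)).
move=> p v w [x xG ->] [y yG ->].
have back n (M N : 'M[R[i]]_n) : M \is unitarymx -> M ^t* *m (M *m N) = N.
  by move=> /unitarymxP /mulmx1C MM; rewrite mulmxA MM mul1mx.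
have /and3P[p1 p2 _] := valP p.
rewrite (left_invariant_linv p gL xG yG) /= -!mulmxE !back//.
rewrite -/(u1_part x) -/(u1_part y) -/(su2_part x) -/(su2_part y).
have u1t v' : lieG v' -> tangent (oneG R) (u1_part v').
  by move=> /lieU1_part [vG _]; exact/tangent1.
have su2t v' : lieG v' -> tangent (oneG R) (su2_part v').
  by move=> /lieSU2_part [vG _]; exact/tangent1.
have zt : tangent (oneG R) z by case: zU => zG _; exact/tangent1.
have cross v' w' : lieG v' -> lieG w' ->
    g (oneG R) (u1_part v') (su2_part w') = 0.
  move=> vG wG; have [a ->] := lieU1_line zU z0 (lieU1_part vG).
  by rewrite (metricZl gR _ zt (su2t _ wG)) orth ?mulr0//; exact: lieSU2_part.
rewrite {1}(partE x) {1}(partE y).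
rewrite (metricDl gR (u1t _ xG) (su2t _ xG) (tangentD (u1t _ yG) (su2t _ yG))).
rewrite (metricDr gR (u1t _ yG) (su2t _ yG) (u1t _ xG)).
rewrite (metricDr gR (u1t _ yG) (su2t _ yG) (su2t _ xG)).
rewrite (cross _ _ xG yG) (metricC gR (su2t _ xG) (u1t _ yG)) (cross _ _ yG xG).
by rewrite addr0 add0r.
Qed.

(* D is the Levi-Civita connection of gl; the indices 1, 2, 3 of the paper are
   0, 1, 2 in 'I_3. *)
Theorem proposition4p1 (R : realType)
    (g0 gl : U1SU2 R -> mat R -> mat R -> R)
    (hg0 : riemannian g0) (hg0_inv : bi_invariant g0)
    (hgl : riemannian gl) (hgl_inv : left_invariant gl)
    (D : (U1SU2 R -> mat R) -> (U1SU2 R -> mat R) -> U1SU2 R -> mat R)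
    (hD : levi_civita gl D)
    (u : 'I_3 -> mat R) (lam : 'I_3 -> R)
    (hu : forall i, lieSU2 (u i))
    (hu_orth : forall i j, g0 (oneG R) (u i) (u j) = (i == j)%:R)
    (hlam : forall i, 0 < lam i)
    (heig : forall i X, lieSU2 X ->
       gl (oneG R) (u i) X = lam i ^+ 2 * g0 (oneG R) (u i) X)
    (e : 'I_3 -> mat R) (he : forall i, e i = rscale (lam i)^-1 (u i))
    (e0 : mat R) (he0 : lieU1 e0) (he0_neq0 : e0 != 0)
    (E0 : mat R) (hE0 : lieG E0) (hE0_unit : gl (oneG R) E0 E0 = 1)
    (hE0_orth : forall X, lieSU2 X -> gl (oneG R) E0 X = 0) :
  let x := lam 0 / lam 2 in
  let y := lam 1 / lam 2 in
  (nonneg_sectional gl D <->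
   [/\ 0 <= 2 * x ^+ 2 + 2 * y ^+ 2 - 3 + x ^+ 4
            - 2 * x ^+ 2 * y ^+ 2 + y ^+ 4,
       0 <= 2 * x ^+ 2 - 3 * x ^+ 4 + 2 * x ^+ 2 * y ^+ 2
            - 2 * y ^+ 2 + 1 + y ^+ 4
     & 0 <= 2 * y ^+ 2 - 3 * y ^+ 4 + 2 * x ^+ 2 * y ^+ 2
            - 2 * x ^+ 2 + 1 + x ^+ 4]
   /\
   [\/ exists c : R, E0 = rscale c e0,
       lam 0 = lam 1 /\ lam 1 = lam 2
     | exists s : 'S_3, lam (s 0) = lam (s 1) /\
         exists a b : R, E0 = rscale a e0 + rscale b (e (s 2))])
  /\ ((exists c : R, E0 = rscale c e0) -> product_metric gl).
Proof.
move=> x y; split; last first.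
  move=> [c eE]; apply: (product_metric_u1 hgl hgl_inv (z := E0)) => //.
    by split=> //; rewrite eE; case: he0 => _ /= ->; rewrite scaler0.
  apply/eqP => E00; move: hE0_unit; rewrite E00 (metric0l hgl); last exact: tangent0.
  by move/eqP; rewrite eq_sym oner_eq0.
have lam_neq0 i : lam i != 0 by rewrite gt_eqF.
have tu i : tangent (oneG R) (u i) by apply/tangent1; case: (hu i).
have eS i : lieSU2 (e i) by rewrite he; exact: lieSU2Z.
have eG i : lieG (e i) by case: (eS i).
have e_orth i j : gl (oneG R) (e i) (e j) = (i == j)%:R.
  rewrite !he (metricZl hgl _ (tu i) (tangentZ _ (tu j))).
  rewrite (metricZr hgl _ (tu j) (tu i)) heig// hu_orth.
  have [->|_] := eqVneq i j; last by rewrite !mulr0.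
  by rewrite mulr1 mulrCA mulrA -expr2 -exprMn mulVf// expr1n.
have uu i : g0 (oneG R) (u i) (u i) = 1 by rewrite hu_orth eqxx.
have un i j : i != j -> g0 (oneG R) (u i) (u j) = 0.
  by move=> /negPf ij; rewrite hu_orth ij.
have [c c0 [l01 l12 l20]] := su2_structure hg0 (hu 0) (hu 1) (hu 2) (uu 0) (uu 1)
  (uu 2) (un 0 1 isT) (un 0 2 isT) (un 1 2 isT) hg0_inv.
(* From e_i = u_i / lambda_i, the bracket [e_i, e_j] is c lambda_m / (lambda_i lambda_j) e_m, and
   extending the fraction by lambda_m gives k lambda_m^2 with [k] symmetric in the indices. *)
pose k := c / (lam 0 * lam 1 * lam 2).
have k0 : k != 0 by rewrite mulf_neq0// invr_eq0 !mulf_neq0.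
have lie_e i j m : lie (u i) (u j) = rscale c (u m) ->
    c / (lam i * lam j) = k * lam m -> lie (e i) (e j) = rscale (k * lam m ^+ 2) (e m).
  move=> luu ck; rewrite !he lieZl lieZr luu !rscaleA; congr rscale.
  rewrite expr2 !mulrA mulfK// -ck invfM; ring.
have h01 : lie (e 0) (e 1) = rscale (k * lam 2 ^+ 2) (e 2).
  by apply: lie_e => //; rewrite /k; field; rewrite !lam_neq0.
have h12 : lie (e 1) (e 2) = rscale (k * lam 0 ^+ 2) (e 0).
  by apply: lie_e => //; rewrite /k; field; rewrite !lam_neq0.
have h20 : lie (e 2) (e 0) = rscale (k * lam 1 ^+ 2) (e 1).
  by apply: lie_e => //; rewrite /k; field; rewrite !lam_neq0.
pose b i := gl (oneG R) (su2_part E0) (e i).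
have ee i : gl (oneG R) (e i) (e i) = 1 by rewrite e_orth eqxx.
have en i j : i != j -> gl (oneG R) (e i) (e j) = 0.
  by move=> /negPf ij; rewrite e_orth ij.
have span := comb4_metric_span hgl eS e_orth hE0 hE0_unit hE0_orth.
have bracket v w := lie_comb4 hgl eS e_orth hE0 v w h01 h12 h20.
have := nonneg_sectionalP hgl hgl_inv hD hE0 (eG 0) (eG 1) (eG 2) hE0_unit (ee 0)
  (ee 1) (ee 2) (hE0_orth _ (eS 0)) (hE0_orth _ (eS 1)) (hE0_orth _ (eS 2))
  (en 0 1 isT) (en 0 2 isT) (en 1 2 isT) span bracket.
have [-> -> ->] := sec_ratio (lam 0) (lam 1) k0 (lam_neq0 2).
rewrite -/x -/y -/(b 0) -/(b 1) -/(b 2) => nnP.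
have skewE i j m : b i * (k * lam j ^+ 2 - k * lam m ^+ 2) = 0 <->
    b i * (lam j ^+ 2 - lam m ^+ 2) = 0.
  rewrite -mulrBr mulrCA; split=> [/eqP|->]; last by rewrite mulr0.
  by rewrite mulf_eq0 (negPf k0) => /eqP.
have condB : [/\ b 0 * (k * lam 1 ^+ 2 - k * lam 2 ^+ 2) = 0,
      b 1 * (k * lam 2 ^+ 2 - k * lam 0 ^+ 2) = 0
    & b 2 * (k * lam 0 ^+ 2 - k * lam 1 ^+ 2) = 0] <->
  [\/ exists c : R, E0 = rscale c e0,
       lam 0 = lam 1 /\ lam 1 = lam 2
     | exists s : 'S_3, lam (s 0) = lam (s 1) /\
         exists a b : R, E0 = rscale a e0 + rscale b (e (s 2))].
  have par := parallel_u1P hgl eS e_orth hE0 he0 he0_neq0.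
  have spn s := span_u1_eP hgl eS e_orth hE0 s he0 he0_neq0.
  have skP := skew_conditionP b hlam.
  split.
    move=> [/skewE q0 /skewE q1 /skewE q2].
    have /skP [q|q|[s [q1' q2']]] := And3 q0 q1 q2.
    - by apply: Or31; exact/par.
    - exact: Or32.
    - by apply: Or33; exists s; split=> //; exact/spn.
  move=> q; suff /skP [q0 q1 q2] : [\/ forall i, b i = 0, lam 0 = lam 1 /\ lam 1 = lam 2
    | exists s : 'S_3, lam (s 0) = lam (s 1) /\ b (s 0) = 0 /\ b (s 1) = 0].
    by split; exact/skewE.
  case: q => [q|q|[s [q1 q2]]].
  - by apply: Or31; exact/par.
  - exact: Or32.
  - by apply: Or33; exists s; split=> //; exact/spn.
split=> [/nnP [B A]|[A B]]; first by split=> //; exact/condB.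
by apply/nnP; split=> //; exact/condB.
Qed.
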